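(* Let $d\geq 2$ be a natural number, and let $X_d$ denote either the space $\mathcal{D}(\mathbb{R}^d)'$ of complex valued Schwartz distributions on $\mathbb{R}^d$ or the space $C(\mathbb{R}^d)$ of continuous complex valued functions on $\mathbb{R}^d$. Let $f\in X_d$ and assume that there is a finite dimensional vector subspace $V\subseteq X_d$ such that: (i) $f\in V$; (ii) $V$ is translation invariant, i.e., $\tau_h(V)\subseteq V$ for all $h\in\mathbb{R}^d$; (iii) $V$ is invariant by orthogonal transformations of $\mathbb{R}^d$, i.e., $O_P(V)\subseteq V$ for all $P\in\mathbf{O}(d)$. Then $f$ is, in distributional sense, an ordinary polynomial on $\mathbb{R}^d$. In particular, $f$ is equal almost everywhere to an ordinary polynomial and, if $f$ is a continuous ordinary function, then it is an ordinary polynomial.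
   Context: $\mathcal{D}(\mathbb{R}^d)$ is the space of test functions (compactly supported infinitely differentiable complex valued functions on $\mathbb{R}^d$), and $f\{\phi\}$ denotes the value of the distribution $f$ at the test function $\phi$. $\mathbf{O}(d)=\{A\in\mathbf{GL}_d(\mathbb{R}): A^t=A^{-1}\}$ is the orthogonal group. For a function $g$ on $\mathbb{R}^d$, $h\in\mathbb{R}^d$ and $P\in\mathbf{GL}_d(\mathbb{R})$: $\tau_h(g)(x)=g(x+h)$ and $O_P(g)(x)=g(Px)$. For a distribution $f\in\mathcal{D}(\mathbb{R}^d)'$: $\tau_h(f)\{\phi\}=f\{\tau_{-h}(\phi)\}$ and $O_P(f)\{\phi\}=\frac{1}{|\det(P)|}f\{O_{P^{-1}}(\phi)\}$ for every test function $\phi$. An ordinary polynomial on $\mathbb{R}^d$ is a function of the form $p(x)=\sum_{|\alpha|\le m}c_\alpha x^\alpha$ with complex coefficients $c_\alpha$ (the zero polynomial included). A distribution $f$ is ''in distributional sense'' an ordinary polynomial if there is an ordinary polynomial $p$ with $f\{\phi\}=\int_{\mathbb{R}^d}p(x)\phi(x)\,dx$ for all $\phi\in\mathcal{D}(\mathbb{R}^d)$; a continuous function is regarded as a distribution by integration against test functions. *)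

(* Defs.v *)
From HB Require Import structures.
From mathcomp Require Import all_boot all_order all_algebra complex.
From mathcomp Require Import all_classical all_reals all_analysis.
Set Implicit Arguments.
Unset Strict Implicit.
Unset Printing Implicit Defensive.
Import Order.TTheory GRing.Theory Num.Theory numFieldNormedType.Exports.
Local Open Scope classical_set_scope.
Local Open Scope ring_scope.
Local Open Scope complex_scope.

(* Complex valued functions take their values in R[i]^o: the topology of the
   complex norm and the structure of a vector space over R[i] are attached to
   this alias of R[i]. *)

Section smooth.
Context {R : realType} {d : nat}.
Implicit Types (g : 'cV[R]_d -> R) (phi psi : 'cV[R]_d -> R[i]^o).
Implicit Types s : seq 'I_d.

(* the iterated partial derivative of g along the coordinates listed in s *)
Definition pderiv s g : 'cV[R]_d -> R :=
  foldr (fun i h => 'D_(delta_mx i 0) h) g s.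

Definition smooth g := forall s x, differentiable (pderiv s g) x.

Definition cpderiv s phi : 'cV[R]_d -> R[i]^o := fun x =>
  pderiv s (@complex.Re R \o phi) x +i* pderiv s (@complex.Im R \o phi) x.

Definition csmooth phi :=
  smooth (@complex.Re R \o phi) /\ smooth (@complex.Im R \o phi).

Definition tsupp phi : set 'cV[R]_d := closure [set x | phi x != 0].

Lemma smooth_coind (S : set ('cV[R]_d -> R)) :
  (forall g, S g -> (forall x, differentiable g x) /\
    forall i, S ('D_(delta_mx i 0) g)) ->
  forall g, S g -> smooth g.
Proof.
move=> hS g Sg s x.
suff /hS[/(_ x)] : S (pderiv s g) by [].
by elim: s => //= i s /hS[_]; exact.
Qed.

Lemma smooth_derive g i : smooth g -> smooth ('D_(delta_mx i 0) g).
Proof. by move=> sg s x; have := sg (rcons s i) x; rewrite /pderiv foldr_rcons. Qed.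

Lemma smooth_cst (c : R) : smooth (cst c).
Proof.
apply: (@smooth_coind [set g | exists c, g = cst c]); last by exists c.
move=> _ [{}c ->]; split=> [x|i]; first exact: differentiable_cst.
by exists 0; apply/funext => x; rewrite derive_cst.
Qed.

Lemma pderiv_lin s (a b : R) g h : smooth g -> smooth h ->
  pderiv s (fun x => a * g x + b * h x) =
  (fun x => a * pderiv s g x + b * pderiv s h x).
Proof.
move=> sg sh; elim: s => //= i s ->; apply/funext => x.
have dg : derivable (pderiv s g) x (delta_mx i 0) by apply/diff_derivable/sg.
have dh : derivable (pderiv s h) x (delta_mx i 0) by apply/diff_derivable/sh.
rewrite (@deriveD _ _ _ (a *: pderiv s g) (b *: pderiv s h)); last 2 first.
- exact: derivableZ.
- exact: derivableZ.
by rewrite !deriveZ.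
Qed.

Lemma smooth_lin (a b : R) g h : smooth g -> smooth h ->
  smooth (fun x => a * g x + b * h x).
Proof.
move=> sg sh s x; rewrite pderiv_lin//.
apply: (@differentiableD _ _ _ (a *: pderiv s g) (b *: pderiv s h)).
- exact/differentiableZ/sg.
- exact/differentiableZ/sh.
Qed.

Lemma differentiable_mulmxl (P : 'M[R]_d) x :
  differentiable (mulmx P : 'cV[R]_d -> 'cV[R]_d) x.
Proof.
have -> : mulmx P = \sum_i (fun x : 'cV[R]_d => x i 0 *: col i P).
  apply/funext => y; apply/colP => k; rewrite fct_sumE !mxE summxE.
  by apply: eq_bigr => i _; rewrite !mxE mulrC.
apply: differentiable_sum => i.
exact/differentiableZl/differentiable_coord.
Qed.

Lemma continuous_mulmxl (P : 'M[R]_d) :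
  continuous (mulmx P : 'cV[R]_d -> 'cV[R]_d).
Proof. by move=> x; exact/differentiable_continuous/differentiable_mulmxl. Qed.

Section affine.
Variables (P : 'M[R]_d) (b : 'cV[R]_d).
Let A (x : 'cV[R]_d) : 'cV[R]_d := P *m x + b.

Let dA x : differentiable A x.
Proof.
apply: (@differentiableD _ _ _ (mulmx P) (cst b)).
- exact: differentiable_mulmxl.
- exact: differentiable_cst.
Qed.

Let deriveA g x v : 'D_v (g \o A) x = 'D_(P *m v) g (A x).
Proof.
rewrite /derive; congr (lim _).
have -> : (fun h : R => h^-1 *: ((g \o A) (h *: v + x) - (g \o A) x)) =
    (fun h : R => h^-1 *: (g (h *: (P *m v) + A x) - g (A x))).
  by apply/funext => h; rewrite /= /A mulmxDr -scalemxAr addrA.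
by [].
Qed.

Let deriveAE g x i : differentiable g (A x) ->
  'D_(delta_mx i 0) (g \o A) x = \sum_j P j i * 'D_(delta_mx j 0) g (A x).
Proof.
move=> dg; rewrite deriveA deriveE//.
have -> : P *m delta_mx i 0 = \sum_j P j i *: (delta_mx j 0 : 'cV[R]_d).
  by rewrite -colE [LHS]matrix_sum_delta; apply: eq_bigr => j _; rewrite big_ord1 mxE.
rewrite linear_sum; apply: eq_bigr => j _.
by rewrite linearZ/= deriveE.
Qed.

Inductive affine_span : ('cV[R]_d -> R) -> Prop :=
| affine_span_comp g : smooth g -> affine_span (g \o A)
| affine_span_lin (c : R) g h : affine_span g -> affine_span h ->
    affine_span (c *: g + h).

Lemma affine_span_sum n (c : 'I_n -> R) (k : 'I_n -> 'cV[R]_d -> R) :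
  (forall j, affine_span (k j)) -> affine_span (\sum_j c j *: k j).
Proof.
move=> ak; elim/big_rec : _ => [|j h _ ah]; last exact: affine_span_lin.
exact: (affine_span_comp (smooth_cst 0)).
Qed.

Lemma affine_span_smooth h : affine_span h -> smooth h.
Proof.
apply: smooth_coind => {}h; elim=> [g sg|c g {}h _ [dg sg] _ [dh sh]].
  have dg y : differentiable g y := sg [::] y.
  split=> [x|i]; first exact: differentiable_comp.
  rewrite [X in affine_span X](_ : _ =
      \sum_j P j i *: ('D_(delta_mx j 0) g \o A)); last first.
    by apply/funext => x; rewrite fct_sumE deriveAE.
  apply: affine_span_sum => j; exact/affine_span_comp/smooth_derive.
split=> [x|i]; first exact/differentiableD/dh/differentiableZ/dg.
rewrite [X in affine_span X](_ : _ =
    c *: 'D_(delta_mx i 0) g + 'D_(delta_mx i 0) h); last first.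
  apply/funext => x; rewrite deriveD; last 2 first.
  - exact/derivableZ/diff_derivable.
  - exact/diff_derivable.
  by rewrite deriveZ//; exact/diff_derivable.
exact: affine_span_lin.
Qed.

Lemma smooth_affine g : smooth g -> smooth (fun x => g (P *m x + b)).
Proof. by move=> sg; apply/affine_span_smooth/(affine_span_comp sg). Qed.

End affine.
End smooth.

Section test_functions.
Context {R : realType} {d : nat}.
Notation V := 'cV[R]_d.
Implicit Types (phi psi : V -> R[i]^o) (K : set V).

Lemma tsupp_subset K phi : compact K ->
  (forall x, phi x != 0 -> K x) -> tsupp phi `<=` K.
Proof.
move=> cK sK; have -> : K = closure K.
  by apply/closure_id/(compact_closed (@norm_hausdorff _ _) cK).
exact: closureS.
Qed.

Lemma compact_tsupp K phi : compact K ->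
  (forall x, phi x != 0 -> K x) -> compact (tsupp phi).
Proof.
move=> cK sK; apply: (subclosed_compact _ cK); first exact: closed_closure.
exact: tsupp_subset.
Qed.

Lemma tsuppP phi x : phi x != 0 -> tsupp phi x.
Proof. exact: (@subset_closure _ [set x | phi x != 0]). Qed.

Lemma csmooth_lin (a : R[i]) phi psi : csmooth phi -> csmooth psi ->
  csmooth (a *: phi + psi).
Proof.
case: a => ar ai [sr si] [tr ti].
pose r := @complex.Re R \o phi; pose i := @complex.Im R \o phi.
pose u := @complex.Re R \o psi; pose v := @complex.Im R \o psi.
split.
- apply: (eq_ind _ smooth (smooth_lin 1 1 (smooth_lin ar (- ai) sr si) tr)).
  apply/funext => x /=; rewrite !mul1r mulNr.
  rewrite -[(_ *: phi + psi) x]/((ar +i* ai) * phi x + psi x).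
  by case: (phi x) => ? ?; case: (psi x) => ? ?.
- apply: (eq_ind _ smooth (smooth_lin 1 1 (smooth_lin ar ai si sr) ti)).
  apply/funext => x /=; rewrite !mul1r.
  rewrite -[(_ *: phi + psi) x]/((ar +i* ai) * phi x + psi x).
  by case: (phi x) => ? ?; case: (psi x) => ? ?.
Qed.

Definition test_pred : {pred V -> R[i]^o} :=
  mem [set phi | csmooth phi /\ compact (tsupp phi)].

Lemma test_submod_closed : submod_closed test_pred.
Proof.
split.
  rewrite inE; split; first by split; exact: smooth_cst.
  by apply: (compact_tsupp (@compact0 V)) => x; rewrite eqxx.
move=> a phi psi; rewrite !inE => -[sphi cphi] [spsi cpsi].
split; first exact: csmooth_lin.
apply: (compact_tsupp (compactU cphi cpsi)) => x nz.
have [phi0|] := eqVneq (phi x) 0; last by left; exact: tsuppP.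
right; apply: tsuppP; apply: contra_neq nz => psi0.
by rewrite !fctE phi0 psi0 scaler0 addr0.
Qed.
HB.instance Definition _ :=
  GRing.isSubmodClosed.Build _ _ test_pred test_submod_closed.

Record test_fun := TestFun {
  test_val :> V -> R[i]^o;
  test_valP : test_val \in test_pred }.

HB.instance Definition _ := [isSub for test_val].
HB.instance Definition _ := [Choice of test_fun by <:].
HB.instance Definition _ := [SubChoice_isSubLmodule of test_fun by <:].

Lemma test_csmooth (phi : test_fun) : csmooth phi.
Proof. by have := test_valP phi; rewrite inE => -[]. Qed.

Lemma test_compact (phi : test_fun) : compact (tsupp phi).
Proof. by have := test_valP phi; rewrite inE => -[]. Qed.

(* [lf_base] is the usual base of neighbourhoods of 0 of the inductive limit
   topology of the Frechet spaces D_K: the convex balanced sets whose trace on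
   each D_K is a neighbourhood of 0 for the seminorms
   max_(|s| <= N) sup_x |d_s phi x|, where D_K is the space of the test
   functions with support in K. *)
Definition lf_base (U : set test_fun) :=
  [/\ forall (t : R) (phi psi : test_fun), 0 <= t <= 1 -> U phi -> U psi ->
        U (t%:C *: phi + (1 - t)%:C *: psi),
      forall (a : R[i]) (phi : test_fun), `|a| <= 1 -> U phi -> U (a *: phi)
    & forall K, compact K -> exists (N : nat) (e : R), 0 < e /\
        forall phi : test_fun, tsupp phi `<=` K ->
          (forall s x, (size s <= N)%N -> `|cpderiv s phi x| <= e%:C) ->
          U phi].

Definition lf_nbhs (phi : test_fun) (A : set test_fun) :=
  exists2 U, lf_base U & forall psi : test_fun, U psi -> A (phi + psi).

Lemma lf_baseI U W : lf_base U -> lf_base W -> lf_base (U `&` W).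
Proof.
move=> [Uc Ub UK] [Wc Wb WK]; split.
- by move=> t phi psi t01 [? ?] [? ?]; split; [exact: Uc|exact: Wc].
- by move=> a phi a1 [? ?]; split; [exact: Ub|exact: Wb].
move=> K cK; have [N [e [e0 Ne]]] := UK _ cK; have [M [f [f0 Mf]]] := WK _ cK.
exists (maxn N M), (Num.min e f); split; first by rewrite lt_min e0.
move=> phi sphi H; split.
- apply: Ne => // s x sN; apply: le_trans (H s x _) _.
    by rewrite (leq_trans sN)// leq_maxl.
  by rewrite lecR ge_min lexx.
- apply: Mf => // s x sN; apply: le_trans (H s x _) _.
    by rewrite (leq_trans sN)// leq_maxr.
  by rewrite lecR ge_min lexx orbT.
Qed.

Lemma lf_base_set0 U : lf_base U -> U 0.
Proof.
move=> [_ _ /(_ _ (@compact0 V))[N [e [e0 H]]]]; apply: H.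
  by apply: tsupp_subset; [exact: compact0|move=> x; rewrite eqxx].
move=> s x _; rewrite (_ : cpderiv s _ x = 0) ?normr0 ?lecR ?ltW//.
have pd0 : pderiv s (cst (0 : R)) x = 0 :> R.
  rewrite [cst _](_ : _ = (fun y => 0 * cst 0 y + 0 * cst (0 : R) y) :> (V -> R)).
    by rewrite pderiv_lin ?mul0r ?addr0//; exact: smooth_cst.
  by apply/funext => y; rewrite !mul0r addr0.
by rewrite /cpderiv [X in X +i* _]pd0 [X in _ +i* X]pd0.
Qed.

Lemma lf_base_half U : lf_base U -> lf_base [set phi | U (phi + phi)].
Proof.
move=> [Uc Ub UK]; split.
- move=> t phi psi t01 Uphi Upsi /=.
  by rewrite addrACA -!scalerDr; exact: Uc.
- by move=> a phi a1 Uphi /=; rewrite -scalerDr; exact: Ub.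
move=> K cK; have [N [e [e0 Ne]]] := UK _ cK.
exists N, (e / 2); split; first by rewrite divr_gt0.
move=> phi sphi H; apply: Ne.
  apply: tsupp_subset => // x nz; apply/sphi/tsuppP; apply: contra_neq nz => phi0.
  by rewrite -[LHS]/(phi x + phi x) phi0 addr0.
move=> s x sN.
have [sr si] := test_csmooth phi.
have -> : cpderiv s (phi + phi : test_fun) x = cpderiv s phi x + cpderiv s phi x.
  have E (f : V -> R) : smooth f -> pderiv s (fun y => f y + f y) x = pderiv s f x + pderiv s f x.
    move=> sf; rewrite (_ : (fun y => _) = (fun y => 1 * f y + 1 * f y)).
      by rewrite pderiv_lin// !mul1r.
    by apply/funext => y; rewrite !mul1r.
  apply/eqP; rewrite eq_complex; apply/andP; split; apply/eqP => /=.
  - rewrite -[RHS]E//; congr (pderiv s _ x); apply/funext => y.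
    rewrite -[LHS]/(complex.Re (phi y + phi y)) /=.
    by case: (phi y).
  - rewrite -[RHS]E//; congr (pderiv s _ x); apply/funext => y.
    rewrite -[LHS]/(complex.Im (phi y + phi y)) /=.
    by case: (phi y).
apply: le_trans (ler_normD _ _) _.
apply: le_trans (lerD (H s x sN) (H s x sN)) _.
by rewrite -rmorphD /= -splitr.
Qed.

Lemma lf_nbhs_filter (phi : test_fun) : ProperFilter (lf_nbhs phi).
Proof.
split.
  by move=> [U /lf_base_set0 U0 /(_ _ U0)].
split.
- exists setT => //; split => // K cK.
  by exists 0%N, 1; split.
- move=> A B [U bU UA] [W bW WB].
  exists (U `&` W); first exact: lf_baseI.
  by move=> psi [/UA ? /WB ?].
- by move=> A B AB [U bU UA]; exists U => // psi /UA/AB.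
Qed.

Lemma lf_nbhs_singleton (phi : test_fun) A : lf_nbhs phi A -> A phi.
Proof. by move=> [U /lf_base_set0 U0 /(_ _ U0)]; rewrite addr0. Qed.

Lemma lf_nbhs_nbhs (phi : test_fun) A : lf_nbhs phi A -> lf_nbhs phi (lf_nbhs^~ A).
Proof.
move=> [U bU UA]; exists [set psi | U (psi + psi)]; first exact: lf_base_half.
move=> psi /= Upsi; exists [set psi | U (psi + psi)]; first exact: lf_base_half.
move=> chi /= Uchi; rewrite -addrA; apply: UA.
have [Uc _ _] := bU.
have := Uc (2^-1 : R) _ _ _ Upsi Uchi.
have -> : 1 - 2^-1 = 2^-1 :> R by rewrite -[X in X - _](mulfV (_ : 2 != 0 :> R))// mulrDl mul1r addrK.
have half (c : test_fun) : (2^-1 : R)%:C *: (c + c) = c.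
  rewrite scalerDr -scalerDl -rmorphD /= -div1r -splitr.
  by rewrite rmorph1 scale1r.
rewrite !half; apply.
by rewrite invr_ge0 ler0n invf_le1 ?ler1n.
Qed.

HB.instance Definition _ := hasNbhs.Build test_fun lf_nbhs.
HB.instance Definition _ := Nbhs_isNbhsTopological.Build test_fun
  lf_nbhs_filter lf_nbhs_singleton lf_nbhs_nbhs.

Definition is_distribution (f : test_fun -> R[i]^o) := linear f /\ continuous f.

Section affine_test.
Variables (P Q : 'M[R]_d) (h : V).
Hypothesis QP : Q *m P = 1%:M.

Lemma test_affine (phi : test_fun) : (fun x => phi (P *m x + h)) \in test_pred.
Proof.
have [sr si] := test_csmooth phi.
rewrite inE; split.
  by split; [exact: (smooth_affine P h sr)|exact: (smooth_affine P h si)].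
pose B (y : V) : V := Q *m (y - h).
have cB : continuous B.
  move=> y; apply: (@continuous_comp V V V (fun y => y - h) (mulmx Q)).
    by apply: continuousB; [by move=> ?|exact: cst_continuous].
  exact: continuous_mulmxl.
apply: (@compact_tsupp (B @` tsupp phi)).
  apply: continuous_compact (@test_compact phi).
  exact: continuous_subspaceT.
move=> x nz; exists (P *m x + h); first exact: tsuppP.
by rewrite /B addrK mulmxA QP mul1mx.
Qed.

End affine_test.
End test_functions.
Arguments test_fun : clear implicits.

Section lebesgue_measure_Rn.
Context {R : realType}.
Notation mR := (measurableTypeR R).

Section cons_measure.
Context (n : nat) (m : {sigma_finite_measure set (n.-tuple mR) -> \bar R}).
Local Open Scope ereal_scope.

Definition tcons (p : mR * n.-tuple mR) : n.+1.-tuple mR :=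
  [tuple of p.1 :: p.2].

Lemma measurable_tcons : measurable_fun [set: mR * n.-tuple mR] tcons.
Proof. exact: measurable_cons. Qed.

(* the product of the Lebesgue measure of R and m, carried to (n.+1)-tuples *)
Definition cons_measure : set (n.+1.-tuple mR) -> \bar R :=
  pushforward (lebesgue_measure \x m) tcons.

Let cons_measure0 : cons_measure set0 = 0.
Proof. by rewrite /cons_measure /pushforward preimage_set0 measure0. Qed.

Let cons_measure_ge0 A : 0 <= cons_measure A.
Proof. by rewrite /cons_measure /pushforward; exact: measure_ge0. Qed.

Let cons_measure_semi_sigma_additive : semi_sigma_additive cons_measure.
Proof.
move=> F mF tF mUF; rewrite /cons_measure /pushforward preimage_bigcup.
apply: measure_semi_sigma_additive.
- by move=> k; rewrite -[X in measurable X]setTI; exact: measurable_tcons.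
- apply/trivIsetP => i j _ _ ij; rewrite -preimage_setI.
  by move/trivIsetP : tF => /(_ _ _ _ _ ij) ->//; rewrite preimage_set0.
- rewrite -preimage_bigcup -[X in measurable X]setTI.
  exact: measurable_tcons.
Qed.

HB.instance Definition _ := isMeasure.Build _ _ _ cons_measure
  cons_measure0 cons_measure_ge0 cons_measure_semi_sigma_additive.

Let tuncons (t : n.+1.-tuple mR) : mR * n.-tuple mR :=
  (thead t, [tuple of behead t]).

Let measurable_tuncons : measurable_fun [set: n.+1.-tuple mR] tuncons.
Proof.
apply/measurable_fun_pairP; split; last exact: measurable_behead.
exact: measurable_tnth.
Qed.

Let tconsK : cancel tcons tuncons.
Proof. by move=> [x t]; congr pair; apply/val_inj. Qed.

Let cons_measure_sigma_finite : sigma_finite setT cons_measure.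
Proof.
have /sigma_finiteP[F [TF ndF Foo]] := sigma_finiteT (@lebesgue_measure R).
have /sigma_finiteP[G [TG ndG Goo]] := sigma_finiteT m.
exists (fun k => tuncons @^-1` (F k `*` G k)).
  rewrite -preimage_bigcup (_ : \bigcup_k _ = setT) ?preimage_setT//.
  rewrite -setXTT TF TG predeqE => -[x y]; split.
    by move=> [k _ []/= ? ?]; split; exists k.
  move=> [/= [k _ Fkx] [l _ Gly]]; exists (maxn k l) => //; split.
  - by move: x Fkx; exact/subsetPset/ndF/leq_maxl.
  - by move: y Gly; exact/subsetPset/ndG/leq_maxr.
move=> k; have [? ?] := Foo k; have [? ?] := Goo k; split.
  rewrite -[X in measurable X]setTI; apply: measurable_tuncons => //.
  exact: measurableX.
rewrite /cons_measure /pushforward -comp_preimage.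
rewrite (_ : tuncons \o tcons = id); last exact/funext/tconsK.
rewrite preimage_id product_measure1E//.
by rewrite lte_mul_pinfty// ge0_fin_numE.
Qed.

HB.instance Definition _ := Measure_isSigmaFinite.Build _ _ _ cons_measure
  cons_measure_sigma_finite.
End cons_measure.

Fixpoint borel_lebesgue n : {sigma_finite_measure set (n.-tuple mR) -> \bar R} :=
  if n is k.+1 then cons_measure (borel_lebesgue k) else dirac [tuple].

(* [borel_lebesgue] lives on the product sigma-algebra; its completion is the
   Lebesgue measure on the sigma-algebra of Lebesgue measurable sets. *)
Definition lebesgue n :=
  @completed_measure_extension _ _ _ (borel_lebesgue n).

Arguments lebesgue n _ : clear implicits.

HB.instance Definition _ n := Measure.on (lebesgue n).
End lebesgue_measure_Rn.
Arguments lebesgue {R} n _.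

Section integration.
Context {R : realType} {d : nat}.
Implicit Types g p : 'cV[R]_d -> R[i]^o.

(* Measures are on tuples, topology and linear algebra on column vectors. *)
Definition vec (t : d.-tuple R) : 'cV[R]_d := \col_i tnth t i.

Definition cintegral g : R[i]^o :=
  (\int[lebesgue d]_t complex.Re (g (vec t))) +i*
  (\int[lebesgue d]_t complex.Im (g (vec t))).

Definition locally_cintegrable g := forall K : set 'cV[R]_d, compact K ->
  (lebesgue d).-integrable (vec @^-1` K) (fun t => (complex.Re (g (vec t)))%:E) /\
  (lebesgue d).-integrable (vec @^-1` K) (fun t => (complex.Im (g (vec t)))%:E).

Definition eq_ae g p := {ae lebesgue d, forall t, g (vec t) = p (vec t)}.

Definition distr_of g : test_fun R d -> R[i]^o :=
  fun phi => cintegral (fun x => g x * phi x).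

(* The monomials are those of total degree at most m; each exponent is then at
   most m, which makes the set of multi-indices finite. *)
Definition is_polynomial p :=
  exists (m : nat) (c : {ffun 'I_d -> 'I_m.+1} -> R[i]),
    p = fun x => \sum_(al : {ffun 'I_d -> 'I_m.+1} | (\sum_i al i <= m)%N)
                   c al * (\prod_i x i 0 ^+ al i)%:C.
End integration.

Section operators.
Context {R : realType} {d : nat}.
Notation V := 'cV[R]_d.
Implicit Types (P : 'M[R]_d) (h : V).

Definition shift_fun h (g : V -> R[i]^o) : V -> R[i]^o := fun x => g (x + h).
Definition comp_mx P (g : V -> R[i]^o) : V -> R[i]^o := fun x => g (P *m x).

Lemma test_shift_subproof h (phi : test_fun R d) :
  shift_fun h phi \in test_pred.
Proof.
rewrite (_ : shift_fun h phi = fun x => phi (1%:M *m x + h)).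
  by apply: (@test_affine _ _ _ 1%:M); rewrite mul1mx.
by apply/funext => x; rewrite mul1mx.
Qed.
Definition test_shift h (phi : test_fun R d) : test_fun R d :=
  TestFun (test_shift_subproof h phi).

Lemma test_comp_subproof P (uP : P \in unitmx) (phi : test_fun R d) :
  comp_mx P phi \in test_pred.
Proof.
rewrite (_ : comp_mx P phi = fun x => phi (P *m x + 0)).
  by apply: (@test_affine _ _ _ (invmx P)); rewrite mulVmx.
by apply/funext => x; rewrite addr0.
Qed.
Definition test_comp P (uP : P \in unitmx) (phi : test_fun R d) : test_fun R d :=
  TestFun (test_comp_subproof uP phi).

Lemma invmx_unitmx P : P \in unitmx -> invmx P \in unitmx.
Proof. by rewrite unitmx_inv. Qed.

Definition distr_shift h (f : test_fun R d -> R[i]^o) : test_fun R d -> R[i]^o :=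
  fun phi => f (test_shift (- h) phi).
Definition distr_comp P (uP : P \in unitmx) (f : test_fun R d -> R[i]^o) :
    test_fun R d -> R[i]^o :=
  fun phi => (`|\det P|^-1)%:C * f (test_comp (invmx_unitmx uP) phi).
End operators.

(* V is a vector subspace of finite dimension: the span of finitely many
   vectors of X *)
Definition finite_dim_subspace (K : fieldType) (X : lmodType K) (V : set X) :=
  exists (n : nat) (e : 'I_n -> X),
    V = [set v | exists c : 'I_n -> K, v = \sum_i c i *: e i].

(* Main.v *)
Require Import Defs.
From HB Require Import structures.
From mathcomp Require Import all_boot all_order all_algebra complex.
From mathcomp Require Import zify ring lra.
From mathcomp Require Import all_classical all_reals all_analysis.
From mathcomp Require Import measurable_realfun.
Import Order.TTheory GRing.Theory Num.Theory numFieldNormedType.Exports.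
Set Implicit Arguments.
Unset Strict Implicit.
Unset Printing Implicit Defensive.
Local Open Scope classical_set_scope.
Local Open Scope ring_scope.
Local Open Scope complex_scope.

(** Choose a basis of the invariant space. Translations by h act on it by commuting
    matrices M(h), an orthogonal P acts by a matrix S, and S conjugates M(P h) to
    M(h). Every eigenvalue of M(h) belongs to a joint eigenvector v of all
    translations, on which they act through a character chi. The vectors
    v, v S, v S^2, ... are joint eigenvectors with characters chi o P^k. As
    eigenvectors with distinct characters are independent, two of the first n+1
    characters coincide if n is the dimension, so chi o P^r = chi for some r with
    1 <= r <= n, and chi o P^(n!) = chi. Now let P be the rotation by pi/n! in a
    plane that contains the coordinate axis of h: this is where two dimensions are
    used. Then P^(n!) h = - h, so chi(h) = chi(- h) and chi(2 h) = 1. Hence all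
    translations along the axes are unipotent ([unipotent_translations]): the n-th
    iterated differences along the axes vanish on the invariant space.

    A continuous function whose n-th iterated differences along the axes vanish is a
    polynomial of degree at most d n. In one variable ([frechet1]), Newton's formula
    shows that it agrees with one polynomial on all the grids of step 1/m, which are
    dense; [frechet] treats the coordinates one at a time. This settles the case of
    continuous functions.

    For a distribution f and a test function u, let F_u(h) be the value of f at the
    translate u(x - h). A distribution is small on test functions that are uniformly
    small, have their support in a fixed compact set and have bounded derivatives,
    because a bound on a second derivative turns a small function into one with a
    small first derivative ([distribution_small]). So F_u is continuous, and it is a
    polynomial of degree at most d n, since its iterated differences are values of
    the iterated differences of f. Moreover, for all test functions u and v,

        int v F_u = int u F_v        ([convolution_exchange]),

    both sides being f evaluated at the convolution of u and v. To see this without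
    integrating functions that take their values in test functions, replace the
    convolution by Riemann sums: f of such a sum is a Riemann sum of v F_u. The
    Riemann sums for (u, v) and (v, u) agree on the lattice of their nodes, hence
    their difference is uniformly small and its derivatives are bounded, so f of the
    difference tends to 0.

    Finally choose a test function psi with int psi q = q(0) for every polynomial q
    of degree at most d n ([reproducing_kernel]). Then

        f(u) = F_u(0) = int psi F_u = int u F_psi,

    so f is the polynomial F_psi. That psi exists is linear algebra in the finite
    dimensional space of moments, given that a continuous function orthogonal to all
    test functions vanishes. The latter, in the form of the lemma of du Bois-Reymond
    ([du_bois_reymond]), also shows that a function that induces the same
    distribution as the polynomial equals it almost everywhere. *)

(** * Commuting families of matrices with an orthogonal symmetry *)

(** Induction on the rank of W: if some F i does not act as a scalar on W, its
    intersection with an eigenspace of F i is smaller, nonzero and still stable, as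
    the F j commute. *)
Lemma common_eigenvector_in (C : numClosedFieldType) (I : Type) n
    (F : I -> 'M[C]_n) (W : 'M[C]_n) :
  (forall i j, F i *m F j = F j *m F i) -> (forall i, stablemx W (F i)) ->
  W != 0 ->
  exists (v : 'rV[C]_n) (chi : I -> C),
    [/\ v != 0, (v <= W)%MS & forall i, v *m F i = chi i *: v].
Proof.
move=> comF; have [r] := ubnP (\rank W).
elim: r W => // r IHr W; rewrite ltnS => rW stW W0.
have [allS|/existsNP[i nS]] := pselect (forall i, exists a, W *m F i = a *: W).
  have [chi Fchi] := choice allS.
  have /rowV0Pn[v vW v0] := W0.
  exists v, chi; split=> // i; have /submxP[u ->] := vW.
  by rewrite -mulmxA Fchi scalemxAr.
have rW0 : (0 < \rank W)%N by rewrite lt0n mxrank_eq0.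
have [a /eigenvalueP[u uA u0]] := eigenvalue_closed (restrictmx W (F i)) rW0.
pose W' := (W :&: eigenspace (F i) a)%MS.
have W'u : (u *m row_base W <= W')%MS.
  rewrite sub_capmx; apply/andP; split.
    by rewrite mulmx_sub// eq_row_base.
  apply/eigenspaceP; rewrite -mulmxA -(mulmxKpV (_ : row_base W *m F i <= row_base W)%MS).
    by rewrite mulmxA -/(conjmx _ _) uA scalemxAl.
  by rewrite stablemx_row_base.
have W'0 : W' != 0.
  apply: contra_neq u0 => W'0; move: W'u; rewrite W'0 submx0 => /eqP.
  by move=> /eqP; rewrite mulmx_free_eq0 ?row_base_free// => /eqP.
have sW' : (W' <= W)%MS by rewrite capmxSl.
have [] := IHr W'; last 2 first.
- exact: W'0.
- move=> v [chi [v0 vW vchi]]; exists v, chi; split => //.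
  exact: submx_trans vW sW'.
- apply: leq_trans rW; rewrite ltn_neqAle mxrankS// andbT.
  apply/negP => /eqP eqr; apply: nS; exists a; apply/eigenspaceP.
  have : (W <= W')%MS by rewrite -(geq_leqif (mxrank_leqif_sup sW')) eqr.
  by move=> /submx_trans; apply; exact: capmxSr.
- move=> j; rewrite sub_capmx; apply/andP; split.
    exact: submx_trans (submxMr _ sW') (stW j).
  apply: submx_trans (submxMr _ (capmxSr _ _)) _.
  by apply: comm_mx_stable_eigenspace; exact: comF.
Qed.

(** For each k other than j some A i separates the values of chi j and chi k. The
    product N of the corresponding A i - chi k i kills all v k but v j, which it
    multiplies by a nonzero scalar; applying N to a linear relation isolates its
    j-th coefficient. *)
Lemma joint_eigenvectors_free (F : fieldType) (I : Type) m n
    (A : I -> 'M[F]_n) (v : 'I_m -> 'rV[F]_n) (chi : 'I_m -> I -> F) :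
  (forall k, v k != 0) -> (forall k i, v k *m A i = chi k i *: v k) ->
  injective chi -> (m <= n)%N.
Proof.
move=> v0 vA chi_inj.
pose B := \matrix_k v k.
suff : row_free B by move=> /eqP <-; exact: rank_leq_col.
rewrite -kermx_eq0; apply: contraT => /rowV0Pn[c /sub_kermxP cB].
move=> /negP; case; apply/eqP/rowP => j; rewrite mxE.
have [N [a [vN aj ak]]] : exists (N : 'M[F]_n) (a : 'I_m -> F),
    [/\ forall k, v k *m N = a k *: v k, a j != 0
       & forall k, k \in [seq k <- enum 'I_m | k != j] -> a k = 0].
  have : j \notin [seq k <- enum 'I_m | k != j] by rewrite mem_filter eqxx.
  elim: [seq _ <- _ | _] => [_|k s IHs].
    by exists 1%:M, (fun=> 1); split => [k||//]; rewrite ?mulmx1 ?scale1r ?oner_neq0.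
  rewrite inE negb_or => /andP[jk /IHs[N [a [vN aj ak]]]].
  have [i /eqP ne] : exists i, chi j i <> chi k i.
    apply/existsNP => eq; move/negP: jk; apply; apply/eqP/chi_inj/funext => i.
    exact: eq.
  exists (N *m (A i - (chi k i)%:M)), (fun l => a l * (chi l i - chi k i)).
  split=> [l||l].
  - by rewrite mulmxA vN -scalemxAl mulmxBr vA mul_mx_scalar -scalerBl scalerA.
  - by rewrite mulf_neq0// subr_eq0.
  - by rewrite inE => /orP[/eqP->|/ak->]; rewrite ?subrr ?mulr0 ?mul0r.
move: cB => /(congr1 (mulmx^~ N)); rewrite mul0mx [c *m B]mulmx_sum_row mulmx_suml.
rewrite (bigD1 j)//= big1 ?addr0 => [|k kj]; last first.
  by rewrite -scalemxAl rowK vN ak ?scale0r ?scaler0// mem_filter kj mem_enum.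
rewrite -scalemxAl rowK vN scalerA => /eqP.
by rewrite scaler_eq0 (negbTE (v0 j)) orbF mulf_eq0 (negbTE aj) orbF => /eqP.
Qed.

Lemma unipotent_eigenvalue1 (C : numClosedFieldType) n (A : 'M[C]_n.+1) :
  (forall a, eigenvalue A a -> a = 1) -> (A - 1) ^+ n.+1 = 0.
Proof.
move=> A1; have [r Dr] := closed_field_poly_normal (char_poly A).
have monA := char_poly_monic A.
move: Dr; rewrite (monicP monA) scale1r => Dr.
have rE : char_poly A = ('X - 1%:P) ^+ n.+1.
  have szr : size r = n.+1.
    by apply: succn_inj; rewrite -(size_prod_XsubC r id) -Dr size_char_poly.
  rewrite Dr -szr (eq_big_seq (fun=> 'X - 1%:P)).
    by rewrite big_const_seq count_predT iter_mulr_1.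
  move=> z zr; rewrite (A1 z)// eigenvalue_root_char Dr root_prod_XsubC //.
have := Cayley_Hamilton A; rewrite rE rmorphXn/= rmorphB/= horner_mx_X horner_mx_C.
by [].
Qed.

(** The core of the argument. A joint eigenvector v with character chi gives, by
    [MP], the joint eigenvectors v S^k with characters chi o P^k. There is no room
    for n.+2 distinct characters in dimension n.+1, so chi is invariant by some P^r
    with 1 <= r <= n.+1; as r divides n.+1`!, the hypothesis on h forces
    chi h = chi (- h), that is, chi (h + h) = 1. *)
Lemma rotated_representation_unipotent (C : numClosedFieldType) (G : nzRingType)
    (V : lmodType G) n (M : V -> 'M[C]_n.+1) (P : V -> V) (S : 'M[C]_n.+1) h :
  (forall u v, M (u + v) = M u *m M v) -> M 0 = 1 -> S \in unitmx ->
  (forall u, exists u', P u' = u) ->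
  (forall u, M (P u) *m S = S *m M u) ->
  iter n.+1`! P h = - h -> (M (h + h) - 1) ^+ n.+1 = 0.
Proof.
move=> MD M0 uS surP MP Ph; apply: unipotent_eigenvalue1 => a /eigenvalueP[w wA w0].
have comM u v : M u *m M v = M v *m M u by rewrite -!MD addrC.
have W0 : eigenspace (M (h + h)) a != 0 by apply/eigenvalueP; exists w.
have [|v [chi [v0 vW vM]]] := common_eigenvector_in comM _ W0.
  by move=> u; apply: comm_mx_stable_eigenspace; exact: comM.
have chiD x y : chi (x + y) = chi x * chi y.
  have := vM (x + y); rewrite MD mulmxA vM -scalemxAl vM scalerA => /eqP.
  by rewrite -subr_eq0 -scalerBl scaler_eq0 (negbTE v0) orbF subr_eq0 => /eqP.
have chi0 : chi 0 = 1.
  have /eqP := vM 0; rewrite M0 mulmx1 -subr_eq0 -[X in X - _]scale1r -scalerBl.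
  by rewrite scaler_eq0 (negbTE v0) orbF subr_eq0 => /eqP.
pose chik (k : 'I_n.+2) u := chi (iter k P u).
pose vk (k : nat) := iter k (mulmx^~ S) v.
have vk0 (k : 'I_n.+2) : vk k != 0.
  by rewrite /vk; elim: (val k) => //= l vl; rewrite mulmx_free_eq0// row_free_unit.
have vkM (k : 'I_n.+2) u : vk k *m M u = chik k u *: vk k.
  rewrite /vk /chik; elim: (val k) u => //= l IHl u.
  by rewrite -mulmxA -MP mulmxA IHl -scalemxAl -iterS iterSr.
have [r [r0 rn chir]] :
    exists r, [/\ (0 < r)%N, (r <= n.+1)%N & forall u, chi (iter r P u) = chi u].
  have : ~ injective chik.
    by move=> /(joint_eigenvectors_free vk0 vkM); rewrite ltnn.
  move=> /existsNP[k] /existsNP[l] /not_implyP[chikl /eqP neq].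
  wlog kl : k l chikl neq / (k < l)%N.
    move=> wl; have [kl|lk|/val_inj kl] := ltngtP k l; first exact: (wl k l).
      by apply: (wl l k) => //; rewrite eq_sym.
    by rewrite kl eqxx in neq.
  exists (l - k)%N; split; first by rewrite subn_gt0.
    by rewrite leq_subLR (leq_trans (leq_ord l))// leq_addl.
  move=> u; have [u' <-] : exists u', iter k P u' = u.
    elim: (val k) {chikl} u => [|k' IH] u; first by exists u.
    have [u1 <-] := surP u; have [u2 <-] := IH u1; by exists u2.
  rewrite -iterD subnK ?(ltnW kl)//.
  by have /(congr1 (fun c => c u')) := chikl.
have chiN u : chi (iter n.+1`! P u) = chi u.
  have /dvdnP[q ->] : (r %| n.+1`!)%N by rewrite dvdn_fact// r0.
  by elim: q => // q IHq; rewrite mulSn iterD chir.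
move: vW => /eigenspaceP; rewrite vM => /eqP.
rewrite -subr_eq0 -scalerBl scaler_eq0 (negbTE v0) orbF subr_eq0 => /eqP <-.
by rewrite chiD -{2}chiN Ph -chiD subrr.
Qed.

Definition lcomb (K : fieldType) (X : lmodType K) n (e : 'I_n -> X) (v : 'rV[K]_n) : X :=
  \sum_i v 0 i *: e i.

Section lcomb.
Variables (K : fieldType) (X : lmodType K).

Lemma lcomb_is_linear n (e : 'I_n -> X) : linear (lcomb e).
Proof.
move=> a u v; rewrite /lcomb scaler_sumr -big_split; apply: eq_bigr => i _ /=.
by rewrite !mxE scalerDl scalerA.
Qed.

HB.instance Definition _ n (e : 'I_n -> X) :=
  GRing.isLinear.Build _ _ _ _ (lcomb e) (lcomb_is_linear e).

Lemma linear_lcomb (Y : lmodType K) (f : X -> Y) n (e : 'I_n -> X) v :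
  linear f -> f (lcomb e v) = lcomb (f \o e) v.
Proof.
move=> lf; pose f' : {linear X -> Y} := HB.pack f (GRing.isLinear.Build _ _ _ _ f lf).
rewrite -[f _]/(f' _) linear_sum; apply: eq_bigr => i _.
by rewrite linearZ.
Qed.

Lemma lcomb_mulmx m n (e : 'I_n -> X) (M : 'M[K]_(m, n)) v :
  lcomb (fun i => lcomb e (row i M)) v = lcomb e (v *m M).
Proof.
rewrite [v *m M]mulmx_sum_row linear_sum; apply: eq_bigr => i _.
by rewrite linearZ.
Qed.

(** In a generating family of minimal size, a relation with a nonzero i-th coefficient
    would allow dropping the i-th member. *)
Lemma finite_dim_basis (V : set X) : finite_dim_subspace V ->
  exists n (e : 'I_n -> X), V = range (lcomb e) /\ injective (lcomb e).
Proof.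
move=> [n0 [e0 Ve0]].
have : exists n (e : 'I_n -> X), V = range (lcomb e).
  exists n0, e0; rewrite Ve0; apply/seteqP; split=> [_ [c ->]|_ [v _ <-]].
    by exists (\row_i c i) => //; apply: eq_bigr => i _; rewrite mxE.
  by exists (v 0).
pose Q n := `[< exists e : 'I_n -> X, V = range (lcomb e) >].
move=> [n Pn]; have /ex_minnP[m /asboolP[e Ve] mmin] : exists n, Q n.
  by exists n; apply/asboolP.
exists m, e; split => // u v /eqP; rewrite -subr_eq0 -linearB => /eqP we.
apply/eqP; rewrite -subr_eq0; move: (u - v) we => {u v} w we.
apply: contraT => /rV0Pn[i wi].
case: m => [|m] in e Ve mmin w we i wi *; first by case: i {wi}.
suff /mmin : Q m by rewrite ltnn.
apply/asboolP; exists (e \o lift i); rewrite Ve; apply/seteqP; split.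
  move=> _ [v _ <-]; exists (\row_j (v - (v 0 i / w 0 i) *: w) 0 (lift i j)) => //.
  transitivity (lcomb e (v - (v 0 i / w 0 i) *: w)).
    rewrite /lcomb [RHS](bigD1_ord i)//= !mxE divfK// subrr scale0r add0r.
    by apply: eq_bigr => j _; rewrite !mxE.
  by rewrite linearB linearZ/= we scaler0 subr0.
move=> _ [v _ <-]; exists (\row_j if unlift i j is Some k then v 0 k else 0) => //.
rewrite /lcomb (bigD1_ord i)//= mxE unlift_none scale0r add0r.
by apply: eq_bigr => j _; rewrite mxE liftK.
Qed.

End lcomb.

Section rotation.
Context {R : realType} {d : nat} (i j : 'I_d).
Hypothesis ij : i != j.

(** The rotation of angle a in the plane of the coordinates i and j, written as
    1 + (cos a - 1) A + sin a B, where A is the projection on this plane and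
    B * B = - A. *)
Definition rotation (a : R) : 'M[R]_d :=
  1%:M + (cos a - 1) *: (delta_mx i i + delta_mx j j)
       + sin a *: (delta_mx j i - delta_mx i j).

Lemma rotationD a b : rotation (a + b) = rotation a *m rotation b.
Proof.
rewrite /rotation; set A := _ + delta_mx j j; set B := _ - delta_mx i j.
have ji : (j == i) = false by rewrite eq_sym (negbTE ij).
have AA : A *m A = A.
  by rewrite mulmxDl !mulmxDr !mul_delta_mx_cond !eqxx ji (negbTE ij) !mulr1n !mulr0n addr0 add0r.
have AB : A *m B = B.
  rewrite mulmxDl !mulmxBr !mul_delta_mx_cond !eqxx ji (negbTE ij) !mulr1n !mulr0n.
  by rewrite sub0r subr0 addrC.
have BA : B *m A = B.
  rewrite mulmxBl !mulmxDr !mul_delta_mx_cond !eqxx ji (negbTE ij) !mulr1n !mulr0n.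
  by rewrite add0r addr0.
have BB : B *m B = - A.
  rewrite mulmxBl !mulmxBr !mul_delta_mx_cond !eqxx ji (negbTE ij) !mulr1n !mulr0n.
  by rewrite sub0r subr0 opprD addrC.
rewrite !(mulmxDl, mulmxDr, mul1mx, mulmx1) -!scalemxAl -!scalemxAr AA AB BA BB.
rewrite cosD sinD; move: A B {AA AB BA BB} => A B.
by apply/matrixP => k l; rewrite !mxE; ring.
Qed.

Lemma rotation0 : rotation 0 = 1%:M.
Proof. by rewrite /rotation cos0 sin0 subrr !scale0r !addr0. Qed.

Lemma rotationV a : rotation (- a) *m rotation a = 1%:M.
Proof. by rewrite -rotationD addNr rotation0. Qed.

Lemma rotation_unit a : rotation a \in unitmx.
Proof. by have /mulmx1_unit[] := rotationV a. Qed.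

Lemma rotation_tr a : (rotation a)^T = invmx (rotation a).
Proof.
have -> : (rotation a)^T = rotation (- a).
  rewrite /rotation cosN sinN scaleNr; move: (cos a - 1) (sin a) => x y.
  by apply/matrixP => k l; rewrite !mxE ![(l == _) && _]andbC [l == k]eq_sym; ring.
by rewrite -[LHS]mulmx1 -(mulmxV (rotation_unit a)) mulmxA rotationV mul1mx.
Qed.

Lemma iter_rotation k a u : iter k (mulmx (rotation a)) u = rotation (a *+ k) *m u :> 'cV_d.
Proof.
elim: k => [|k IHk] /=; first by rewrite mulr0n rotation0 mul1mx.
by rewrite IHk mulmxA -rotationD mulrS.
Qed.

Lemma rotation_pi (t : R) :
  rotation pi *m (t *: delta_mx i 0) = - (t *: delta_mx i 0) :> 'cV_d.
Proof.
rewrite /rotation cospi sinpi scale0r addr0 -scalemxAr -scalerN; congr (_ *: _).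
rewrite mulmxDl mul1mx -scalemxAl mulmxDl !mul_delta_mx_cond eqxx.
rewrite eq_sym (negbTE ij) mulr1n mulr0n addr0 -[X in X + _]scale1r -scalerDl.
by rewrite addrCA subrr addr0 scaleN1r.
Qed.
End rotation.

(** Stated for an abstract representation T, so that it covers functions and
    distributions alike. The rotation angle is pi / n.+1`!, where n.+1 is the dimension
    of V; the second coordinate of the plane of rotation exists as d >= 2. *)
Lemma unipotent_translations (R : realType) (d : nat) (X : lmodType R[i])
    (V : set X) (T : 'cV[R]_d -> X -> X) : (2 <= d)%N ->
  finite_dim_subspace V -> (forall h, linear (T h)) ->
  (forall h k g, T (h + k) g = T h (T k g)) -> (forall g, T 0 g = g) ->
  (forall h g, V g -> V (T h g)) ->
  (forall P : 'M[R]_d, P \in unitmx -> P^T = invmx P -> exists Q : X -> X,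
    [/\ linear Q, injective Q, (forall g, V g -> V (Q g))
      & (forall h g, T h (Q g) = Q (T (P *m h) g))]) ->
  exists n, forall g i t, V g ->
    iter n (fun g => T (t *: delta_mx i 0) g - g) g = 0.
Proof.
move=> d2 /finite_dim_basis[n [e [VE einj]]] Tl TD T0 TV TO.
have matrix_of (f : X -> X) : linear f -> (forall g, V g -> V (f g)) ->
    exists M : 'M[R[i]]_n, forall v, f (lcomb e v) = lcomb e (v *m M).
  move=> lf fV; have /choice[c fc] : forall i, exists c, lcomb e c = f (e i).
    move=> i; have : V (f (e i)).
      apply: fV; rewrite VE; exists (delta_mx 0 i) => //.
      rewrite /lcomb (bigD1 i)//= mxE !eqxx scale1r big1 ?addr0// => j ji.
      by rewrite mxE (negbTE ji) andbF scale0r.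
    by rewrite VE => -[w _ <-]; exists w.
  exists (\matrix_i c i) => v; rewrite linear_lcomb// -lcomb_mulmx.
  by apply: eq_bigr => i _; rewrite rowK fc.
have /choice[M TM] : forall h, exists M : 'M[R[i]]_n, forall v, T h (lcomb e v) = lcomb e (v *m M).
  by move=> h; apply: matrix_of => // g; exact: TV.
case: n e VE einj matrix_of M TM => [|n] e VE einj matrix_of M TM.
  exists 0%N => g i t; rewrite VE => -[v _ <-] /=.
  by rewrite /lcomb big_ord0.
have eqM (A B : 'M[R[i]]_n.+1) : (forall v, lcomb e (v *m A) = lcomb e (v *m B)) -> A = B.
  by move=> AB; apply/row_matrixP => i; rewrite !rowE; exact/einj/AB.
exists n.+1 => g i t; rewrite VE => -[v _ <-].
have [j ij] : exists j, i != j.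
  apply/existsP; rewrite -negb_forall; apply/negP => /forallP all_i.
  have : (#|'I_d| <= #|pred1 i|)%N.
    by apply: subset_leq_card; apply/fintype.subsetP => k _; rewrite inE eq_sym all_i.
  by rewrite card1 card_ord leqNgt d2.
have uni : (M (t *: delta_mx i 0) - 1) ^+ n.+1 = 0.
  (* an angle whose n.+1`!-fold multiple is a half turn, n.+1 being the dimension *)
  have [Q [lQ Qinj QV QT]] := TO _ (rotation_unit ij (pi / (n.+1`!)%:R)) (rotation_tr ij _).
  have [S QS] := matrix_of Q lQ QV.
  have := @rotated_representation_unipotent _ _ _ n M
    (mulmx (rotation i j (pi / (n.+1`!)%:R))) S (2^-1 *: (t *: delta_mx i 0)).
  rewrite -scalerDl -[2^-1]div1r -splitr scale1r; apply.
  - by move=> u w; apply: eqM => x; rewrite addrC -TM TD !TM mulmxA.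
  - by apply: eqM => x; rewrite -TM T0 mulmx1.
  - rewrite -row_free_unit -kermx_eq0; apply: contraT => /rowV0Pn[w /sub_kermxP wS].
    rewrite -(inj_eq einj) -(inj_eq Qinj) !QS wS mul0mx.
    by rewrite eqxx.
  - move=> u; exists (rotation i j (- (pi / (n.+1`!)%:R)) *m u).
    by rewrite mulmxA -rotationD// subrr rotation0 mul1mx.
  - by move=> u; apply: eqM => x; rewrite !mulmxA -!(QS, TM) QT.
  - rewrite iter_rotation// -[_ *+ _]mulr_natr divfK ?pnatr_eq0 -?lt0n ?fact_gt0//.
    by rewrite scalerA rotation_pi.
suff iterE k : iter k (fun g => T (t *: delta_mx i 0) g - g) (lcomb e v) =
    lcomb e (v *m (M (t *: delta_mx i 0) - 1) ^+ k).
  by rewrite iterE uni mulmx0 linear0.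
elim: k => [|k IHk] /=; first by rewrite expr0 mulmx1.
by rewrite IHk TM -linearB exprSr mulmxA [in RHS]mulmxBr mulmx1.
Qed.

(** * Functions with a vanishing iterated difference along each axis *)

Definition fdiff (V W : zmodType) (h : V) (g : V -> W) : V -> W :=
  fun x => g (x + h) - g x.

Section newton.
Variables (R : realType).

Lemma newton_forward (V : zmodType) (h : V) (g : V -> R) k n x : (k < n)%N ->
  g (x + h *+ k) = \sum_(j < n) 'C(k, j)%:R * iter j (fdiff h) g x.
Proof.
elim: k n g x => [|k IHk] [//|n] g x kn.
  rewrite mulr0n addr0 big_ord_recl bin0 mul1r big1 ?addr0// => i _.
  by rewrite bin0n mul0r.
have -> : g (x + h *+ k.+1) = fdiff h g (x + h *+ k) + g (x + h *+ k).
  by rewrite /fdiff subrK mulrSr addrA.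
rewrite (IHk n)// (IHk n.+1)// 1?ltnW//.
rewrite [in RHS]big_ord_recl [X in _ + X = _]big_ord_recl !bin0 !mul1r addrCA.
congr (_ + _); rewrite -big_split; apply: eq_bigr => i _ /=.
by rewrite binS natrD mulrDl addrC -iterSr.
Qed.

Lemma fdiff0 (V : zmodType) (h : V) k : iter k (fdiff h) (cst 0) = cst 0 :> (V -> R).
Proof. by elim: k => //= k ->; apply/funext => x; rewrite /fdiff/= subrr. Qed.

Lemma newton_forward_vanish (V : zmodType) (h : V) (g : V -> R) N k x :
  iter N (fdiff h) g = cst 0 ->
  g (x + h *+ k) = \sum_(j < N) 'C(k, j)%:R * iter j (fdiff h) g x.
Proof.
move=> gN; rewrite (@newton_forward _ _ _ k (N + k.+1)) ?leq_addl//.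
rewrite big_split_ord/= [X in _ + X]big1 ?addr0// => i _.
by rewrite addnC iterD gN fdiff0 mulr0.
Qed.

(** The binomial coefficient ['X choose j]. *)
Definition binpoly j : {poly R} := (j`!%:R)^-1 *: \prod_(l < j) ('X - l%:R%:P).

Lemma binpolyE j k : (binpoly j).[k%:R] = 'C(k, j)%:R.
Proof.
have fj : (j`!)%:R != 0 :> R by rewrite pnatr_eq0 -lt0n fact_gt0.
rewrite /binpoly hornerZ; apply: (mulfI fj); rewrite mulVKf// -natrM mulnC bin_ffact.
rewrite horner_prod; have [kj|jk] := ltnP k j.
  rewrite (bigD1 (Ordinal kj))//= !hornerE subrr mul0r.
  by rewrite ffact_small.
rewrite ffact_prod natr_prod; apply: eq_bigr => l _.
by rewrite !hornerE natrB// ltnW// (leq_trans (ltn_ord l)).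
Qed.

Lemma size_binpoly j : (size (binpoly j) <= j.+1)%N.
Proof.
apply: leq_trans (size_scale_leq _ _) _.
by rewrite size_prod_XsubC /index_enum -enumT size_enum_ord.
Qed.

Lemma eq_poly_nat (p q : {poly R}) : (forall k : nat, p.[k%:R] = q.[k%:R]) -> p = q.
Proof.
move=> pq; apply/eqP; rewrite -subr_eq0; apply: contraT => nz.
have := @max_poly_roots _ (p - q) [seq (k%:R : R) | k <- iota 0 (size (p - q))] nz.
rewrite size_map size_iota ltnn; apply.
  by apply/allP => _ /mapP[k _ ->]; rewrite rootE !hornerE pq subrr.
rewrite map_inj_in_uniq ?iota_uniq// => a b _ _ /eqP.
by rewrite eqr_nat => /eqP.
Qed.

(** By Newton's formula G agrees on any arithmetic progression with a polynomial;
    for the progressions of step 1/m these polynomials agree with the one of step 1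
    because they do so at infinitely many integers. The points - L + k/m are dense,
    and G is continuous. *)
Lemma frechet1 (G : R -> R) N : continuous G ->
  (forall t, iter N (fdiff t) G = cst 0) ->
  forall s, G s = \sum_(j < N) iter j (fdiff 1) G 0 * (binpoly j).[s].
Proof.
move=> cG GN; pose p : {poly R} := \sum_(j < N) iter j (fdiff 1) G 0 *: binpoly j.
suff Gp s : G s = p.[s].
  by move=> s; rewrite Gp horner_sum; apply: eq_bigr => j _; rewrite hornerZ.
have newtonp x t (k : nat) : G (x + t *+ k) =
    (\sum_(j < N) iter j (fdiff t) G x *: binpoly j).[k%:R].
  rewrite (newton_forward_vanish _ _ (GN t)) horner_sum; apply: eq_bigr => j _.
  by rewrite hornerZ binpolyE mulrC.
have grid (L m k : nat) : (0 < m)%N -> G (- L%:R + k%:R / m%:R) = p.[- L%:R + k%:R / m%:R].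
  move=> m0; have m1 : m%:R != 0 :> R by rewrite pnatr_eq0 -lt0n.
  pose q := \sum_(j < N) iter j (fdiff m%:R^-1) G (- L%:R) *: binpoly j.
  (* both interpolate G at all the integers *)
  have -> : p = q \Po (m%:R *: ('X + L%:R%:P)).
    apply: eq_poly_nat => l; rewrite horner_comp !hornerE.
    have := newtonp 0 1 l; rewrite add0r => <-.
    rewrite -natrD -natrM -newtonp mulrnA -[_^-1 *+ m]mulr_natl mulfV// natrD.
    by rewrite addrCA addNr addr0.
  rewrite horner_comp !hornerE addrAC addNr add0r [m%:R * _]mulrC divfK//.
  by rewrite -newtonp mulr_natl.
apply: contrapT => ne.
have cGp : {for s, continuous (fun x => G x - p.[x])}.
  by apply: (@continuousB _ R^o _ G (fun x => p.[x])); [exact: cG|exact: continuous_horner].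
have : \forall x \near s, G x - p.[x] != 0.
  apply: (cGp [set y | y != 0]); apply: open_nbhs_nbhs; split; first exact: open_neq.
  by move=> /=; rewrite subr_eq0; exact/eqP.
move=> /nbhs_ballP[e e0 he].
pose L := (Num.truncn `|s|).+1; pose m := (Num.truncn e^-1).+1.
pose k := Num.truncn ((s + L%:R) * m%:R).
have m0 : 0 < m%:R :> R by rewrite ltr0n.
have Ls : 0 <= s + L%:R.
  have /ltW : `|s| < L%:R by exact: truncnS_gt.
  by rewrite ler_norml => /andP[]; rewrite lerNl; lra.
have /truncn_itv/andP[k1 k2] : 0 <= (s + L%:R) * m%:R by rewrite mulr_ge0// ltW.
have em : m%:R^-1 < e.
  rewrite invf_plt ?posrE//; exact: truncnS_gt.
suff /he : ball s e (- L%:R + k%:R / m%:R) by rewrite /= grid// subrr eqxx.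
rewrite -ball_normE /= ltr_norml; apply/andP; split.
- apply: (@lt_le_trans _ _ 0); first by rewrite oppr_lt0.
  by rewrite opprD opprK addrA subr_ge0 ler_pdivrMr.
- apply: le_lt_trans em; rewrite opprD opprK addrA lerBlDl [leRHS](_ : _ = (k%:R + 1) / m%:R); last by rewrite mulrDl mul1r.
  by rewrite ler_pdivlMr// ltW// (lt_le_trans k2)// -addn1 natrD.
Qed.
End newton.

Section real_polynomials.
Context {R : realType} {d : nat}.
Notation V := 'cV[R]_d.
Notation E i := (delta_mx i 0 : V).

Definition rmonom (e : 'I_d -> nat) : V -> R := fun x => \prod_i x i 0 ^+ e i.

(** A polynomial of total degree at most m. The degree bound is kept in sight since a
    reproducing test function exists only for bounded degree. *)
Definition rpoly m (g : V -> R) := exists c : {ffun 'I_d -> 'I_m.+1} -> R,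
  g = fun x => \sum_(al : {ffun 'I_d -> 'I_m.+1} | (\sum_i al i <= m)%N)
                 c al * rmonom (fun i => al i) x.

Lemma rpoly_lin m a g h : rpoly m g -> rpoly m h -> rpoly m (fun x => a * g x + h x).
Proof.
move=> [c ->] [b ->]; exists (fun al => a * c al + b al); apply/funext => x.
rewrite mulr_sumr -big_split; apply: eq_bigr => al _ /=.
by rewrite mulrDl mulrA.
Qed.

Lemma rpoly0 m : rpoly m (cst 0).
Proof. by exists (fun=> 0); apply/funext => x; rewrite big1// => al; rewrite mul0r. Qed.

Lemma rpoly_sum m (I : Type) (r : seq I) (P : pred I) (a : I -> R) (g : I -> V -> R) :
  (forall i, P i -> rpoly m (g i)) ->
  rpoly m (fun x => \sum_(i <- r | P i) a i * g i x).
Proof.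
move=> pg; elim: r => [|i r IHr].
  by rewrite (_ : (fun=> _) = cst 0); [exact: rpoly0|apply/funext => x; rewrite big_nil].
have [Pi|Pi] := boolP (P i); last first.
  by rewrite (_ : (fun=> _) = (fun x => \sum_(i <- r | P i) a i * g i x))//;
    apply/funext => x; rewrite big_cons (negbTE Pi).
rewrite (_ : (fun=> _) = (fun x => a i * g i x + \sum_(i <- r | P i) a i * g i x)).
  by apply: rpoly_lin => //; exact: pg.
by apply/funext => x; rewrite big_cons Pi.
Qed.

Lemma rpoly_monom m (e : 'I_d -> nat) : (\sum_i e i <= m)%N -> rpoly m (rmonom e).
Proof.
move=> em; have lem i : (e i < m.+1)%N.
  by rewrite ltnS (leq_trans _ em)// (bigD1 i)//= leq_addr.
pose al0 : {ffun 'I_d -> 'I_m.+1} := [ffun i => Ordinal (lem i)].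
exists (fun al => (al == al0)%:R); apply/funext => x.
rewrite (bigD1 al0)/=; last by under eq_bigr do rewrite ffunE.
rewrite eqxx mul1r big1 ?addr0 => [|al /andP[_ /negbTE->]]; last by rewrite mul0r.
by apply: eq_bigr => i _; rewrite ffunE.
Qed.

Lemma rpoly_mul_horner m n i (p : {poly R}) g : (size p <= n)%N -> rpoly m g ->
  rpoly (m + n) (fun x => p.[x i 0] * g x).
Proof.
move=> pn [c ->].
rewrite (_ : (fun=> _) = fun x : V => \sum_(k < n) p`_k *
   \sum_(al : {ffun 'I_d -> 'I_m.+1} | (\sum_i al i <= m)%N) c al * (x i 0 ^+ k * rmonom (fun i => al i) x)).
  apply: rpoly_sum => k _; apply: rpoly_sum => al alm.
  rewrite (_ : (fun=> _) = rmonom (fun j => al j + k * (j == i))%N).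
    apply: rpoly_monom; rewrite big_split/= leq_add// (bigD1 i)//= eqxx muln1 big1 ?addn0 1?ltnW//.
    by move=> j /negbTE->; rewrite muln0.
  apply/funext => x; rewrite /rmonom (bigD1 i)//= [in RHS](bigD1 i)//= mulrA.
  rewrite eqxx muln1 addnC exprD; congr (_ * _).
  by apply: eq_bigr => j /negbTE->; rewrite muln0 addn0.
apply/funext => x; rewrite (horner_coef_wide _ pn) mulr_suml; apply: eq_bigr => k _.
rewrite -mulrA; congr (_ * _); rewrite mulr_sumr; apply: eq_bigr => al _.
by rewrite mulrCA.
Qed.

Lemma rmonom_continuous e : continuous (rmonom e).
Proof.
move=> x; have := @cvg_big R _ _ 1 xpredT (@mul_continuous R) V (nbhs x)
  (index_enum 'I_d) (fun i y => y i 0 ^+ e i) (fun i => x i 0 ^+ e i) _.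
apply=> i _.
apply: (@continuous_comp _ _ _ (fun y : V => y i 0) (fun t => t ^+ e i)).
  exact: coord_continuous.
exact: exprn_continuous.
Qed.

Lemma rpoly_continuous m g : rpoly m g -> continuous g.
Proof.
move=> [c ->] x; have := @cvg_big R _ _ 0 (fun al : {ffun 'I_d -> 'I_m.+1} => \sum_i al i <= m)%N
  pseudometric_normed_Zmodule.add_continuous V (nbhs x) (index_enum _)
  (fun al y => c al * rmonom (fun i => al i) y)
  (fun al => c al * rmonom (fun i => al i) x) _.
apply=> al _.
by apply: cvgM; [exact: cvg_cst|exact: rmonom_continuous].
Qed.

Lemma fdiff_comp (h : V) (A : V -> V) h' (g : V -> R) k : (forall x, A (x + h) = A x + h') ->
  iter k (fdiff h) (g \o A) = iter k (fdiff h') g \o A.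
Proof.
by move=> AD; elim: k => //= k ->; apply/funext => x; rewrite /fdiff/= AD.
Qed.

Lemma fdiffC (h h' : V) (g : V -> R) : fdiff h (fdiff h' g) = fdiff h' (fdiff h g).
Proof. by apply/funext => x; rewrite /fdiff/= [x + h + h']addrAC; ring. Qed.

Lemma fdiff_continuous (h : V) (g : V -> R) : continuous g -> continuous (fdiff h g).
Proof.
move=> cg x; have cs : {for x, continuous (fun y : V => g (y + h))}.
  apply: (@continuous_comp _ _ _ (fun y : V => y + h) g); last exact: cg.
  by apply: continuousD; [by move=> ?|exact: cst_continuous].
by apply: (@continuousB _ R^o); [exact: cs|exact: cg].
Qed.

(** Induction on the number k of coordinates on which g depends. In the last of them
    Newton's formula expands g as a combination of binomial polynomials whose
    coefficients are iterated differences of g restricted to a coordinate hyperplane,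
    and these depend on one coordinate less. *)
Lemma frechet N (g : V -> R) : continuous g ->
  (forall i t, iter N (fdiff (t *: E i)) g = cst 0) -> rpoly (d * N) g.
Proof.
suff gen k : (k <= d)%N -> forall g, continuous g ->
    (forall i t, iter N (fdiff (t *: E i)) g = cst 0) ->
    (forall (i : 'I_d) x t, (k <= i)%N -> g (x + t *: E i) = g x) -> rpoly (k * N) g.
  by move=> cg gN; apply: gen => // i x t; rewrite leqNgt ltn_ord.
elim: k => [|k IHk] kd {}g cg gN gk.
  have g0 x : g x = g 0.
    rewrite [x]matrix_sum_delta.
    under eq_bigr do rewrite big_ord1.
    elim/big_rec: _ => // i y _ <-.
    by rewrite addrC gk.
  rewrite (_ : g = fun x => g 0 * rmonom (fun=> 0%N) x + cst 0 x).
    by apply: rpoly_lin (rpoly0 _); apply: rpoly_monom; rewrite big1.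
  by apply/funext => x; rewrite /rmonom big1 ?mulr1 ?addr0.
pose i := Ordinal kd.
(* the projection along the axis i *)
pose A (x : V) : V := x - x i 0 *: E i.
have gE : g = fun x => \sum_(j < N) 1 * ((binpoly R j).[x i 0] * (iter j (fdiff (E i)) g (A x))).
  apply/funext => x; pose G s := g (A x + s *: E i).
  have GE j (t s : R) : iter j (fdiff t) G s = iter j (fdiff (t *: E i)) g (A x + s *: E i).
    elim: j s => //= j IHj s; rewrite /fdiff !IHj; congr (_ - _).
    by rewrite scalerDl addrA.
  have <- : G (x i 0) = g x by rewrite /G /A subrK.
  rewrite (@frechet1 _ G N).
  - apply: eq_bigr => j _; rewrite mul1r mulrC; congr (_ * _).
    by rewrite GE scale1r scale0r addr0.
  - move=> s; apply: continuous_comp; last exact: cg.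
    apply: (@cvgD _ V); first exact: cvg_cst.
    by apply: (@cvgZl _ V).
  - by move=> t; apply/funext => s; rewrite GE gN.
rewrite gE mulSn addnC; apply: rpoly_sum => j _; apply: rpoly_mul_horner.
  exact: leq_trans (size_binpoly _ _) _.
have AD y l t : A (y + t *: E l) = A y + (if l == i then 0 else t) *: E l.
  rewrite /A !mxE eqxx andbT eq_sym; case: eqP => [->|].
    by rewrite mulr1 scalerDl scale0r addr0 opprD addrACA subrr addr0.
  by rewrite mulr0 addr0 addrAC.
have cA : continuous A.
  move=> x; apply: (@continuousB _ V V id (fun y : V => y i 0 *: E i)); first by move=> ?.
  by apply: continuousZr_tmp; exact: coord_continuous.
have gj : continuous (iter j (fdiff (E i)) g) by elim: (val j) => // l; exact: fdiff_continuous.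
apply: IHk; first exact: ltnW.
- by move=> x; apply: continuous_comp; [exact: cA|exact: gj].
- move=> l t; rewrite (fdiff_comp _ _ (fun y => AD y l t)).
  move: (if _ then _ else _) => t'.
  have iterC n : iter n (fdiff (t' *: E l)) (iter j (fdiff (E i)) g) =
      iter j (fdiff (E i)) (iter n (fdiff (t' *: E l)) g).
    elim: n => //= n ->; elim: (val j) => //= j' <-.
    by rewrite fdiffC.
  by rewrite iterC gN fdiff0; apply/funext.
- move=> l x t kl /=; rewrite AD; case: eqP => [_|/eqP li].
    by rewrite scale0r addr0.
  have kl' : (k < l)%N by rewrite ltn_neqAle kl andbT eq_sym.
  elim: (val j) (A x) => [|j' IHj] y /=; first exact: gk.
  by rewrite /fdiff addrAC !IHj.
Qed.

End real_polynomials.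

Section complex_parts.
Context {R : realType}.

Lemma complex_sum (I : Type) (r : seq I) (P : pred I) (a b : I -> R) :
  \sum_(i <- r | P i) (a i +i* b i) = (\sum_(i <- r | P i) a i) +i* (\sum_(i <- r | P i) b i).
Proof. by elim/big_rec3: _ => // i x y z _ ->. Qed.

Lemma Re_le_norm (z : R[i]) : (`|complex.Re z|)%:C <= `|z|.
Proof.
rewrite normc_def lecR -sqrtr_sqr ler_wsqrtr// lerDl sqr_ge0//.
Qed.

Lemma Im_le_norm (z : R[i]) : (`|complex.Im z|)%:C <= `|z|.
Proof.
rewrite normc_def lecR -sqrtr_sqr ler_wsqrtr// lerDr sqr_ge0//.
Qed.

Lemma norm_le_parts (z : R[i]) : `|z| <= (`|complex.Re z| + `|complex.Im z|)%:C.
Proof.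
case: z => a b /=; rewrite (_ : a +i* b = a%:C + 'i * b%:C); last first.
  by apply/eqP; rewrite eq_complex /= !(mul0r, mulr0, mul1r, add0r, subr0, addr0) !eqxx.
apply: le_trans (ler_normD _ _) _; rewrite normrM normCi mul1r rmorphD /=.
by rewrite lerD// normc_def/= expr0n addr0 sqrtr_sqr.
Qed.

Lemma continuous_parts (T : topologicalType) (g : T -> R[i]^o) :
  continuous g <-> continuous (@complex.Re R \o g) /\ continuous (@complex.Im R \o g).
Proof.
split=> [cg|[cr ci]].
  split=> x; apply/cvgrPdist_lt => e e0; have e0' : 0 < e%:C :> R[i] by rewrite ltcR.
    move: (cg x) => /cvgrPdist_lt/(_ _ e0'); apply: filterS => y.
    move=> /(le_lt_trans (Re_le_norm _)); rewrite ltcR /=.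
    by case: (g x) (g y) => ? ? [].
  move: (cg x) => /cvgrPdist_lt/(_ _ e0'); apply: filterS => y.
  move=> /(le_lt_trans (Im_le_norm _)); rewrite ltcR /=.
  by case: (g x) (g y) => ? ? [].
move=> x; apply/cvgrPdist_lt => -[e e'] /=; rewrite ltcE/= => /andP[/eqP-> e0].
have e2 : 0 < e / 2 by rewrite divr_gt0.
move: (cr x) (ci x) => /cvgrPdist_lt/(_ _ e2) hr /cvgrPdist_lt/(_ _ e2) hi.
near=> y; apply: le_lt_trans (norm_le_parts _) _; rewrite ltcR [ltRHS]splitr.
have : `|complex.Re (g x) - complex.Re (g y)| < e / 2 by near: y.
have : `|complex.Im (g x) - complex.Im (g y)| < e / 2 by near: y.
by case: (g x) (g y) => a b [a' b'] /= ? ?; rewrite ltrD.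
Unshelve. all: by end_near. Qed.

End complex_parts.

Section translation_invariant.
Context {R : realType} {d : nat}.
Notation V := 'cV[R]_d.
Implicit Types f g : V -> R[i]^o.

Definition cpoly m f := rpoly m (@complex.Re R \o f) /\ rpoly m (@complex.Im R \o f).

Lemma cpoly_is_polynomial m f : cpoly m f -> is_polynomial f.
Proof.
move=> [[a fa] [b fb]]; exists m, (fun al => a al +i* b al); apply/funext => x.
have Ere := congr1 (fun h => h x) fa; have Eim := congr1 (fun h => h x) fb.
move: Ere Eim => /=; rewrite /rmonom; case: (f x) => u v /= -> ->.
rewrite -complex_sum; apply: eq_bigr => al _.
by apply/eqP; rewrite eq_complex /= !(mulr0, addr0, subr0, add0r) !eqxx.
Qed.

Lemma fdiff_part (op : R[i] -> R) (h : V) f k : (forall u v, op (u - v) = op u - op v) ->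
  op \o iter k (fdiff h) f = iter k (fdiff h) (op \o f).
Proof.
move=> opB; elim: k => //= k <-; apply/funext => x.
by rewrite /= /fdiff opB.
Qed.

Lemma cfrechet N f : continuous f ->
  (forall i t, iter N (fdiff (t *: delta_mx i 0)) f = cst 0) -> cpoly (d * N) f.
Proof.
move=> /continuous_parts[cr ci] fN; split; apply: frechet => // i t.
  rewrite -fdiff_part ?fN; last by case=> ? ? [].
  by apply/funext.
rewrite -fdiff_part ?fN; last by case=> ? ? [].
by apply/funext.
Qed.

Lemma continuous_invariant_polynomial (V : set ('cV[R]_d -> R[i]^o)) f :
  (2 <= d)%N ->
  (forall g, V g -> continuous g) ->
  finite_dim_subspace V ->
  V f ->
  (forall (h : 'cV[R]_d) g, V g -> V (shift_fun h g)) ->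
  (forall P : 'M[R]_d, P \in unitmx -> P^T = invmx P ->
        forall g, V g -> V (comp_mx P g)) ->
  is_polynomial f.
Proof.
move=> d2 cV fV Vf Vshift Vorth.
have [|||||n Vn] := @unipotent_translations R d _ V shift_fun d2 fV.
- by [].
- by move=> h k g; apply/funext => x; rewrite /shift_fun addrA addrAC.
- by move=> g; apply/funext => x; rewrite /shift_fun addr0.
- exact: Vshift.
- move=> P uP oP; exists (comp_mx P); split.
  + by [].
  + move=> g g' gg'; apply/funext => x.
    have := congr1 (fun k => k (invmx P *m x)) gg'.
    by rewrite /comp_mx mulmxA mulmxV// mul1mx.
  + exact: Vorth.
  + by move=> h g; apply/funext => x; rewrite /comp_mx /shift_fun mulmxDr.
apply: (@cpoly_is_polynomial (d * n)); apply: cfrechet; first exact: cV.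
by move=> i t; rewrite -[RHS](Vn f i t Vf).
Qed.
End translation_invariant.

(** * Lebesgue measure on boxes and continuous functions *)

Section lebesgue_facts.
Context {R : realType} {d : nat}.
Notation V := 'cV[R]_d.
Notation mR := (measurableTypeR R).
Notation T := (d.-tuple mR).
Notation LT := (caratheodory_type (mu_ext (borel_lebesgue (R:=R) d))).

Lemma borel_lebesgue_measurable (A : set T) : measurable A -> measurable (A : set LT).
Proof. exact: caratheodory_measurable_mu_ext. Qed.

Lemma lebesgueE (A : set T) : measurable A -> lebesgue d A = borel_lebesgue d A.
Proof. by move=> mA; rewrite /lebesgue /completed_measure_extension measurable_mu_extE. Qed.

Definition tuple_box (I : 'I_d -> set mR) : set T := [set t | forall i, I i (tnth t i)].

Lemma measurable_tuple_box (I : 'I_d -> set mR) : (forall i, measurable (I i)) ->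
  measurable (tuple_box I).
Proof.
move=> mI; rewrite (_ : tuple_box I = \bigcap_(i in [set: 'I_d]) (fun t : T => tnth t i) @^-1` I i).
  apply: fin_bigcap_measurable => [|i _]; first exact: finite_finset.
  rewrite -[X in measurable X]setTI.
  by apply: measurable_tnth => //; exact: mI.
by apply/seteqP; split=> [t It i _|t It i]; [exact: It|exact: (It i Logic.I)].
Qed.
End lebesgue_facts.

(** The measure is an iterated product, so the first interval splits off. *)
Lemma borel_lebesgue_box (R : realType) d (I : 'I_d -> set (measurableTypeR R)) :
  (forall i, measurable (I i)) ->
  borel_lebesgue d (tuple_box I) = (\prod_i lebesgue_measure (I i))%E.
Proof.
elim: d I => [|d IHd] I mI.
  rewrite big_ord0 /= diracE mem_set//.
  by move=> [].
rewrite big_ord_recl -IHd//=.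
rewrite /cons_measure /pushforward -product_measure1E//.
  congr ((_ \x _)%E _); apply/seteqP; split=> [[x t] It|[x t] [Ix It] i].
    split=> [|i]; first by have := It ord0; rewrite tnth0.
    by have := It (lift ord0 i); rewrite tnthS.
  have [j ->|->] := unliftP ord0 i; last by rewrite tnth0.
  by rewrite tnthS; exact: It.
exact: measurable_tuple_box.
Qed.

Lemma lebesgue_tuple_box_lty (R : realType) d (I : 'I_d -> set (measurableTypeR R)) :
  (forall i, measurable (I i)) -> (forall i, (lebesgue_measure (I i) < +oo)%E) ->
  (lebesgue d (tuple_box I) < +oo)%E.
Proof.
move=> mI Ioo; rewrite lebesgueE; last exact: measurable_tuple_box.
rewrite borel_lebesgue_box//.
under eq_bigr => i _ do rewrite -(@fineK _ (lebesgue_measure (I i))) ?ge0_fin_numE//.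
by rewrite prodEFin ltry.
Qed.

Section borel_continuous.
Context {R : realType} {d : nat}.
Notation V := 'cV[R]_d.
Notation mR := (measurableTypeR R).
Notation T := (d.-tuple mR).
Notation LT := (caratheodory_type (mu_ext (borel_lebesgue (R:=R) d))).

(** An open set is a countable union of boxes with rational centres and radii of the
    form 1/n, and boxes are measurable for the product sigma-algebra. *)
Lemma measurable_open_preimage (U : set V) : open U ->
  measurable ([set t : T | U (vec t)]).
Proof.
move=> oU; pose B (p : 'cV[rat]_d * nat) : set T :=
  tuple_box (fun i => ball (ratr (p.1 i 0) : R) p.2.+1%:R^-1).
pose F p := if `[< [set t | B p t] `<=` [set t | U (vec t)] >] then B p else set0.
rewrite (_ : [set _ | _] = \bigcup_p F p).
  apply: countable_bigcupT_measurable; first exact: countableP.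
  move=> p; rewrite /F; case: asboolP => // _; apply: measurable_tuple_box => i.
  by apply: open_measurable; exact: ball_open.
apply/seteqP; split=> [t Ut|t [p _]]; last first.
  by rewrite /F; case: asboolP => // h /h.
have : nbhs (vec t) U by apply: open_nbhs_nbhs.
move=> /nbhs_ballP[e /= e0 eU].
(* a box of radius r < e / 2 around a rational point within r of t lies in the ball
   of radius e *)
pose k := Num.truncn (2 / e); pose r : R := k.+1%:R^-1.
have r0 : 0 < r by rewrite invr_gt0 ltr0n.
have re : r + r < e.
  have : 2 / e < k.+1%:R by exact: truncnS_gt.
  by rewrite ltr_pdivrMr// => h; rewrite -mulr2n -mulr_natl /r ltr_pdivrMr ?ltr0n// mulrC.
have /choice[q qP] : forall i, exists q : rat, `|ratr q - tnth t i| < r.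
  move=> i; have [|q] := @rat_in_itvoo R (tnth t i - r) (tnth t i + r).
    by rewrite ltrBlDr -addrA ltrDl addr_gt0.
  by rewrite in_itv/= => /andP[q1 q2]; exists q; rewrite ltr_distl q1.
exists ((\col_i q i), k) => //; rewrite /F; case: asboolP => [_ i|].
  by rewrite -ball_normE /= mxE.
case=> s Bs; apply: eU; rewrite -ball_normE /=.
apply: (le_lt_trans _ re); rewrite -[`|_|]/(mx_norm _) mx_normrE; apply: bigmax_le.
  by rewrite addr_ge0// ltW.
move=> [i j] _ /=; rewrite !mxE.
have := Bs i; rewrite -ball_normE /= mxE => h1; have h2 := qP i.
rewrite -[X in `|X|](subrKA (ratr (q i))).
by rewrite (le_trans (ler_normD _ _))// lerD// ltW// distrC.
Qed.

Lemma measurable_continuous_vec (g : V -> R) : continuous g ->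
  measurable_fun [set: T] (fun t => g (vec t)).
Proof.
move=> cg; apply: (measurability _ (RGenOpens.measurableE R)).
move=> _ [_ [a [b ->] <-]]; rewrite setTI.
apply: (@measurable_open_preimage (g @^-1` `]a, b[%classic)).
by apply: open_comp => // x _; exact: cg.
Qed.

Lemma completed_measurable_fun (g : T -> R) : measurable_fun [set: T] g ->
  measurable_fun [set: LT] (g : LT -> R).
Proof.
move=> mg _ Y mY; rewrite setTI; apply: borel_lebesgue_measurable.
by rewrite -[X in measurable X]setTI; exact: mg.
Qed.

End borel_continuous.

(** * Riemann sums *)

Section riemann_sums.
Context {R : realType} {d : nat}.
Notation V := 'cV[R]_d.
Notation mR := (measurableTypeR R).
Notation T := (d.-tuple mR).
Notation LT := (caratheodory_type (mu_ext (borel_lebesgue (R:=R) d))).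

Lemma coord_le_norm (x : V) i : `|x i 0| <= `|x|.
Proof.
rewrite -[leRHS]/(mx_norm _) mx_normrE.
exact: (le_bigmax _ (fun ij : 'I_d * 'I_1 => `|x ij.1 ij.2|) (i, 0)).
Qed.

Lemma compact_box (a b : 'I_d -> R) :
  compact [set x : V | forall i, a i <= x i 0 <= b i].
Proof.
pose C := [set v : 'rV[R]_d | forall i, `[a i, b i]%classic (v ord0 i)].
have cC : compact C.
  apply: (@rV_compact _ _ (fun i => `[a i, b i]%classic)) => i.
  exact: segment_compact.
rewrite (_ : [set _ | _] = trmx @` C); last first.
  apply/seteqP; split=> [x xab|_ [v vC <-] i].
    by exists x^T; rewrite ?trmxK// => i; rewrite /= in_itv/= mxE.
  by have := vC i; rewrite /= in_itv/= mxE.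
apply: continuous_compact => //; apply: continuous_subspaceT => v.
move=> A /nbhs_ballP[e /= e0 eA]; apply/nbhs_ballP; exists e => // w [_ vw].
by apply: eA; split=> // i j; rewrite !mxE; exact: vw.
Qed.

Definition sup_box (L : R) : set V := [set x | forall i, `|x i 0| <= L].

Lemma compact_sup_box L : compact (sup_box L).
Proof.
rewrite (_ : sup_box L = [set x | forall i, - L <= x i 0 <= L]).
  exact: (@compact_box (fun=> - L) (fun=> L)).
by apply/seteqP; split=> x xL i; [rewrite -ler_norml|rewrite ler_norml]; exact: xL.
Qed.

Lemma sup_boxS (L M : R) : L <= M -> sup_box L `<=` sup_box M.
Proof. by move=> LM x xL i; exact: le_trans (xL i) LM. Qed.

Lemma compact_sub_sup_box (K : set V) : compact K ->
  exists L : nat, K `<=` sup_box L%:R.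
Proof.
move=> /compact_bounded[M [_ /(_ (`|M| + 1))]].
rewrite (le_lt_trans (ler_norm _)) ?ltrDl// => /(_ isT) KM.
exists (Num.truncn (`|M| + 1)).+1 => x Kx i; apply: le_trans (coord_le_norm x i) _.
by apply: le_trans (KM _ Kx) _; rewrite ltW// truncnS_gt.
Qed.

Lemma compact_support_bound (K : set V) (g : V -> R) : compact K ->
  continuous g -> (forall x, g x != 0 -> K x) ->
  exists2 C, 0 <= C & forall x, `|g x| <= C.
Proof.
move=> cK cg gK; have : compact (g @` K).
  by apply: continuous_compact => //; exact: continuous_subspaceT.
move=> /compact_bounded[M [_ /(_ (`|M| + 1))]].
rewrite (le_lt_trans (ler_norm _)) ?ltrDl// => /(_ isT) gM.
exists (`|M| + 1); first by rewrite addr_ge0.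
move=> x; have [->|/gK Kx] := eqVneq (g x) 0; first by rewrite normr0 addr_ge0.
by apply: gM; exists x.
Qed.

Definition closed_cube L : set T := tuple_box (fun=> `[- L, L]%classic).

Lemma measurable_closed_cube L : measurable (closed_cube L).
Proof. exact: measurable_tuple_box. Qed.

Lemma lebesgue_closed_cube_lty L : (lebesgue d (closed_cube L) < +oo)%E.
Proof.
by apply: lebesgue_tuple_box_lty => // i; rewrite lebesgue_measure_itv/= -EFinB; case: ifP => _; rewrite ltry.
Qed.

Lemma closed_cubeP L t : closed_cube L t <-> sup_box L (vec t).
Proof.
split=> tL i; have := tL i; first by rewrite /= in_itv/= -ler_norml mxE.
by rewrite mxE ler_norml /= in_itv.
Qed.

Definition lattice m (k : 'cV[int]_d) : V := \col_i ((k i 0)%:~R / m.+1%:R).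

Definition riemann_sum m (g : V -> R) : R :=
  (m.+1%:R ^+ d)^-1 * \sum_(k \in [set: 'cV[int]_d]) g (lattice m k).

(** The points of the integer lattice with coordinates in [- B, B], indexed by a finite
    type: sums over them are ordinary finite sums. *)
Definition box_point B (n : {ffun 'I_d -> 'I_(B + B).+1}) : 'cV[int]_d :=
  \col_i ((n i)%:Z - B%:Z).

Lemma box_point_inj B : injective (@box_point B).
Proof.
move=> n n' /colP nn'; apply/ffunP => i; apply/val_inj.
by have := nn' i; rewrite !mxE => /addIr[].
Qed.

Lemma sum_box_points (W : nmodType) B (a : 'cV[int]_d -> W) :
  (forall k, a k != 0 -> forall i, `|k i 0| <= B%:Z) ->
  \sum_n a (@box_point B n) = \sum_(k \in [set: 'cV[int]_d]) a k.
Proof.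
move=> aB; rewrite (fsbigE [seq @box_point B n | n <- index_enum {ffun 'I_d -> 'I_(B + B).+1}])//.
- rewrite big_map; apply: eq_bigl => n.
  by rewrite in_setT.
- by rewrite map_inj_uniq ?index_enum_uniq//; exact: box_point_inj.
- suff out (k : 'cV[int]_d) : k \notin [seq @box_point B n | n <- index_enum {ffun 'I_d -> 'I_(B + B).+1}] ->
      a k = 0 by move=> k _; exact: out.
  move=> nk; apply/eqP; apply: contraNT nk => /aB kB.
  have kB' i : (`|(k i 0 + B%:Z)%R|%N < (B + B).+1)%N by move: (kB i); lia.
  apply/mapP; exists [ffun i => Ordinal (kB' i)]; first exact: mem_index_enum.
  by apply/colP => i; rewrite !mxE ffunE /=; move: (kB i); lia.
Qed.

Definition mesh L m := (L * m.+1)%N.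
Definition mesh_point L m n : V := lattice m (@box_point (mesh L m) n).

Lemma lattice_sup_box L m k : sup_box L%:R (lattice m k) ->
  forall i, `|k i 0| <= (mesh L m)%:Z.
Proof.
move=> kL i; have := kL i; rewrite mxE normrM normfV [`|m.+1%:R|]ger0_norm// ler_pdivrMr//.
by rewrite -natrM -intr_norm -[X in _ <= X]/((L * m.+1)%:Z%:~R) ler_int.
Qed.

Definition grid_floor m (t : T) : 'cV[int]_d := \col_i Num.floor (m.+1%:R * tnth t i).

Definition grid_cube m (k : 'cV[int]_d) : set T :=
  tuple_box (fun i => `[(k i 0)%:~R / m.+1%:R, (k i 0 + 1)%:~R / m.+1%:R[%classic).

Lemma grid_cubeE m k t : grid_cube m k t <-> grid_floor m t = k.
Proof.
split=> [kt|<- i].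
  apply/colP => i; rewrite mxE; apply: floor_def.
  by have := kt i; rewrite /= in_itv/= ler_pdivrMr// ltr_pdivlMr// mulrC.
rewrite /= in_itv/= mxE ler_pdivrMr// ltr_pdivlMr// [tnth t i * _]mulrC.
by rewrite floor_itv.
Qed.

Lemma grid_floor_dist m t i : `|vec t i 0 - lattice m (grid_floor m t) i 0| <= m.+1%:R^-1.
Proof.
have /grid_cubeE/(_ i) := erefl (grid_floor m t); rewrite /= in_itv/= => /andP[h1 h2].
rewrite !mxE in h1 h2 *; rewrite ger0_norm ?subr_ge0// lerBlDl ltW// (lt_le_trans h2)//.
by rewrite intrD mulrDl mul1r.
Qed.

(** Every point is within the mesh of the lattice, coordinate by coordinate. *)
Lemma floor_lattice m (x : V) :
  exists j, forall i, `|x i 0 - lattice m j i 0| <= m.+1%:R^-1.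
Proof.
exists (grid_floor m [tuple x i 0 | i < d]) => i.
by have := grid_floor_dist m [tuple x i 0 | i < d] i; rewrite mxE tnth_mktuple.
Qed.

Lemma measurable_grid_cube m k : measurable (grid_cube m k : set LT).
Proof. by apply: borel_lebesgue_measurable; exact: measurable_tuple_box. Qed.

Lemma lebesgue_grid_cube m k : lebesgue d (grid_cube m k) = ((m.+1%:R ^+ d)^-1)%:E.
Proof.
rewrite lebesgueE; last by apply: measurable_tuple_box.
rewrite borel_lebesgue_box//.
under eq_bigr => i _.
  rewrite lebesgue_measure_itv/= lte_fin ltr_pM2r ?invr_gt0// ltr_int ltrDl ltr01.
  rewrite -EFinB -mulrBl intrD addrAC subrr add0r mul1r; over.
by rewrite prodEFin prodr_const card_ord exprVn.
Qed.

End riemann_sums.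

Lemma integrable_cst_indic dT (T : measurableType dT) (R : realType)
    (mu : {measure set T -> \bar R}) (A : set T) (c : R) :
  measurable A -> (mu A < +oo)%E ->
  mu.-integrable setT (fun t => (c * \1_A t)%:E).
Proof.
move=> mA muA; rewrite (_ : (fun t => _) = (fun t => c%:E * (\1_A t)%:E)%E)//.
apply: integrableZl => //; apply/integrableP; split; first exact/measurable_EFinP.
rewrite (eq_integral (fun x => (\1_A x)%:E)) ?integral_indic ?setIT// => t _.
by rewrite gee0_abs// lee_fin.
Qed.

Section riemann_sum_cvg.
Context {R : realType} {d : nat}.
Notation V := 'cV[R]_d.
Notation mR := (measurableTypeR R).
Notation T := (d.-tuple mR).
Notation LT := (caratheodory_type (mu_ext (borel_lebesgue (R:=R) d))).
Notation mu := (lebesgue (R:=R) d).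

Variables (L : nat) (g : V -> R).
Hypothesis cg : continuous g.
Hypothesis gL : forall x, g x != 0 -> sup_box L%:R x.

Let step m (t : LT) : R := g (lattice m (grid_floor m t)).
Let cube m n : set T := grid_cube m (@box_point d (mesh L m) n).

Let riemann_sumE m :
  riemann_sum m g = \sum_n (m.+1%:R ^+ d)^-1 * g (@mesh_point R d L m n).
Proof.
rewrite /riemann_sum -(@sum_box_points d _ (mesh L m)) ?mulr_sumr// => k /gL.
exact: lattice_sup_box.
Qed.

Let stepE m t : step m t = \sum_n g (@mesh_point R d L m n) * \1_(@cube m n) t.
Proof.
pose a k : R := g (lattice m k) * \1_(grid_cube m k) t.
rewrite [RHS](@sum_box_points d _ (mesh L m) a); last first.
  move=> k ak; apply: lattice_sup_box; apply: gL.
  by apply: contra_neq ak => gk; rewrite /a gk mul0r.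
rewrite -(fsbig_widen [set grid_floor m t] setT)//.
  by rewrite fsbig_set1 /a indicE mem_set ?mulr1//; exact/grid_cubeE.
move=> k [_ /= nk]; rewrite /a indicE memNset ?mulr0// => /grid_cubeE tk.
by apply: nk; rewrite tk.
Qed.

Let cube_lty m n : (mu (@cube m n) < +oo)%E.
Proof. by rewrite [X in (X < _)%E]lebesgue_grid_cube ltry. Qed.

Let integrable_term m n :
  mu.-integrable setT (fun t => (g (mesh_point n) * \1_(@cube m n) t)%:E).
Proof. by apply: integrable_cst_indic; [exact: measurable_grid_cube|exact: cube_lty]. Qed.

Let measurable_step m : measurable_fun setT (fun t => (step m t)%:E).
Proof.
rewrite (_ : (fun t => _) =
    (fun t => \sum_n (g (mesh_point n) * \1_(@cube m n) t)%:E)%E).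
  by apply: emeasurable_sum => n; exact: measurable_int (integrable_term n).
by apply/funext => t; rewrite sumEFin stepE.
Qed.

Let integral_step m : (\int[mu]_t (step m t)%:E = (riemann_sum m g)%:E)%E.
Proof.
rewrite (eq_integral (fun t : LT =>
    \sum_n (g (mesh_point n) * \1_(@cube m n) t)%:E)%E); last first.
  by move=> t _; rewrite sumEFin stepE.
rewrite integral_sum//= riemann_sumE -sumEFin; apply: eq_bigr => n _.
under eq_integral do rewrite EFinM.
have mc : measurable (@cube m n : set LT) by exact: measurable_grid_cube.
rewrite integralZl//; last first.
  rewrite -[X in _.-integrable _ X](_ : (fun t => (1 * \1_(@cube m n) t)%:E) = _).
    by apply: integrable_cst_indic; [exact: mc|exact: cube_lty].
  by apply/funext => t; rewrite mul1r.
by rewrite integral_indic// setIT [X in (_ * X)%E]lebesgue_grid_cube -EFinM mulrC.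
Qed.

Let measurable_g : measurable_fun setT (fun t : LT => (g (vec t))%:E).
Proof.
apply/measurable_EFinP; apply: completed_measurable_fun.
exact: (measurable_continuous_vec cg).
Qed.

Let step_cvg (t : LT) : (step m t)%:E @[m --> \oo] --> (g (vec t))%:E.
Proof.
apply: cvg_EFin; first exact: nearW.
apply: (@cvg_comp _ _ _ (fun m => lattice m (grid_floor m t)) g _ (nbhs (vec t))); last exact: cg.
apply/cvgrPdist_lt => e e0; near=> m.
have em : m.+1%:R^-1 < e.
  by near: m; exact: near_infty_natSinv_lt (PosNum e0).
apply: le_lt_trans em; rewrite -[leLHS]/(mx_norm _) mx_normrE.
apply: bigmax_le => [|[i j] _ /=]; first by rewrite invr_ge0.
by rewrite (ord1 j) !mxE -[X in X <= _]/(`|_ - _|); have := grid_floor_dist m t i; rewrite !mxE.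
Unshelve. all: by end_near. Qed.

Let dominated : exists2 h : LT -> \bar R, mu.-integrable setT h &
  forall t m, (`|(step m t)%:E| <= h t)%E.
Proof.
have [C C0 gC] := compact_support_bound (@compact_sup_box R d L%:R) cg gL.
exists (fun t => (C * \1_(closed_cube (L.+1%:R : R)) t)%:E).
  apply: integrable_cst_indic; last exact: lebesgue_closed_cube_lty.
  by apply: borel_lebesgue_measurable; exact: measurable_closed_cube.
move=> t m; rewrite abse_EFin lee_fin indicE.
have [tB|tB] := boolP (t \in closed_cube _); first by rewrite mulr1; exact: gC.
rewrite mulr0 normr_le0; apply: contraNT tB => /gL lt.
rewrite in_setE; apply/closed_cubeP => i.
have := grid_floor_dist m t i; have := lt i; move: (lattice _ _ _ _) => l l1 l2.
rewrite -[X in `|X|](subrK l) (le_trans (ler_normD _ _))//.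
by rewrite -natr1 addrC lerD// (le_trans l2)// invf_le1 ?ler1n.
Qed.

Let dominated_cvg : mu.-integrable setT (fun t => (g (vec t))%:E) /\
  (fun m => \int[mu]_t (step m t)%:E)%E @ \oo --> (\int[mu]_t (g (vec t))%:E)%E.
Proof.
have [h ih hstep] := dominated.
have [] := @dominated_convergence _ LT R mu setT measurableT (fun m t => (step m t)%:E)
  (fun t => (g (vec t))%:E) h measurable_step measurable_g _ ih _.
- by apply: aeW => t _; exact: step_cvg.
- by apply: aeW => t m _; exact: hstep.
- by move=> ? _ ?.
Qed.

Lemma integrable_compact_support : mu.-integrable setT (fun t => (g (vec t))%:E).
Proof. exact: dominated_cvg.1. Qed.

(** The Riemann sum of step [1 / m.+1] is the integral of the function that takes
    on each grid cube the value of [g] at its lower corner. These functions converge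
    pointwise to [g] and are dominated by a multiple of the indicator of a fixed
    cube. *)
Lemma riemann_sum_cvg :
  riemann_sum m g @[m --> \oo] --> \int[mu]_t g (vec t).
Proof.
have := dominated_cvg.2; under eq_fun do rewrite integral_step.
rewrite -[X in _ --> X -> _]fineK; first by move/fine_cvg.
exact: integrable_fin_num integrable_compact_support.
Qed.
End riemann_sum_cvg.

(** * Functions with vanishing integrals on boxes *)

Section vanishing_on_boxes.
Context {R : realType} {d : nat}.
Notation V := 'cV[R]_d.
Notation mR := (measurableTypeR R).
Notation T := (d.-tuple mR).
Notation LT := (caratheodory_type (mu_ext (borel_lebesgue (R:=R) d))).
Notation mu := (lebesgue (R:=R) d).

(** The completed measure of E is an infimum over countable Borel covers; B is the
    intersection of covers that come closer and closer to this infimum. *)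
Lemma completed_outer_borel (E : set LT) : (mu E < +oo)%E -> measurable E ->
  exists B : set T, [/\ measurable B, E `<=` B & mu (B `\` E) = 0%E].
Proof.
move=> Eoo mE.
have Efin : mu E \is a fin_num by rewrite ge0_fin_numE.
have /choice[F FP] : forall n : nat, exists F : (set T)^nat,
    [/\ forall k, measurable (F k), E `<=` \bigcup_k F k &
    (\sum_(k <oo) borel_lebesgue d (F k) < mu E + (n.+1%:R^-1)%:E)%E].
  move=> n; have /ereal_inf_lt[_ [F [mF EF] <-] lt] : (mu E < mu E + (n.+1%:R^-1)%:E)%E.
    by rewrite lteDl// lte_fin invr_gt0.
  by exists F; split; [exact: mF|exact: EF|exact: lt].
pose U n : set T := \bigcup_k F n k.
have mU n : measurable (U n) by apply: bigcupT_measurable => k; have [] := FP n.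
pose B : set T := \bigcap_n U n.
have mB : measurable B by exact: bigcapT_measurable.
have EB : E `<=` B by move=> t Et n _; have [_ EF _] := FP n; exact: EF.
have muB : (mu B <= mu E)%E.
  apply/lee_addgt0Pr => e e0.
  have [n ne] : exists n : nat, n.+1%:R^-1 < e.
    exists (Num.truncn e^-1); rewrite invf_plt ?posrE//; exact: truncnS_gt.
  have [_ _ /ltW lt] := FP n.
  apply: (@le_trans _ _ (mu (U n))).
    apply: le_measure; rewrite ?inE; try exact: borel_lebesgue_measurable.
    by move=> t /(_ n Logic.I).
  rewrite [leLHS]lebesgueE//; apply: (@le_trans _ _ (\sum_(k <oo) borel_lebesgue d (F n k))%E).
    by apply: measure_sigma_subadditive => // k; have [] := FP n.
  by apply: (le_trans lt); rewrite leeD2l// lee_fin ltW.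
exists B; split => //; have mB' : measurable (B : set LT) by exact: borel_lebesgue_measurable.
rewrite measureD//; last exact: le_lt_trans Eoo.
rewrite (setIidr EB); transitivity (mu E - mu E)%E; last exact: subee.
congr (_ - _)%E; by apply/eqP; rewrite eq_le muB le_measure ?inE.
Qed.

Definition obox (a b : 'I_d -> R) : set T := tuple_box (fun i => `]a i, b i[%classic).

Lemma measurable_obox a b : measurable (obox a b).
Proof. exact: measurable_tuple_box. Qed.

Definition oboxes : set (set T) := [set B | exists a b, B = obox a b].

Lemma oboxes_setI : setI_closed oboxes.
Proof.
move=> _ _ [a [b ->]] [a' [b' ->]].
exists (fun i => Num.max (a i) (a' i)), (fun i => Num.min (b i) (b' i)).
apply/seteqP; split=> [t [t1 t2] i|t tI].
  have := t1 i; have := t2 i; rewrite /= !in_itv/= gt_max lt_min => /andP[p q] /andP[r s].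
  by rewrite p q r s.
by split=> i; have := tI i; rewrite /= !in_itv/= gt_max lt_min
  => /andP[/andP[p q] /andP[r s]]; rewrite ?p ?q ?r ?s.
Qed.

(** The inverse image of an open interval by a coordinate is the union of the open boxes
    that are bounded by n in the other directions. *)
Lemma measurable_oboxes : @measurable _ T = <<s oboxes>>.
Proof.
apply/seteqP; split; last first.
  apply: smallest_sub; first exact: sigma_algebra_measurable.
  by move=> _ [a [b ->]]; exact: measurable_obox.
move=> A mA; pose G := g_sigma_algebraType oboxes.
suff mid : measurable_fun [set: G] (id : G -> T).
  by have := mid measurableT A mA; rewrite setTI.
apply/measurable_fun_tnthP => i.
apply: (measurability _ (RGenOpens.measurableE R)).
move=> _ [_ [x [y ->] <-]]; rewrite setTI.
rewrite (_ : _ @^-1` _ = \bigcup_n (obox (fun j => if j == i then x else - n%:R)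
    (fun j => if j == i then y else n%:R) : set G)).
  apply: bigcupT_measurable => n; apply: sub_gen_smallest.
  by eexists; eexists; reflexivity.
apply/seteqP; split=> [t /= txy|t [n _ /(_ i)]]; last by rewrite eqxx.
exists (\max_j (Num.truncn `|tnth t j|).+1)%N => // j /=.
case: eqP => [->//|_]; rewrite in_itv/= -ltr_norml.
apply: (@lt_le_trans _ _ (Num.truncn `|tnth t j|).+1%:R); first exact: truncnS_gt.
by rewrite ler_nat; exact: (leq_bigmax_cond (P := xpredT) j).
Qed.

(** Open boxes are stable by intersection and generate the Borel sets, so Dynkin's
    theorem spreads the vanishing of the integral to bounded Borel sets; outer
    approximation spreads it to sets that are measurable for the completed
    measure. *)
Lemma ae_eq0_boxes (g : T -> R) :
  (forall n : nat, mu.-integrable (obox (fun=> - n%:R) (fun=> n%:R)) (fun t => (g t)%:E)) ->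
  (forall a b, (\int[mu]_(t in obox a b) (g t)%:E = 0)%E) ->
  {ae mu, forall t, g t = 0}.
Proof.
move=> gint g0; pose Q n := obox (fun=> - n%:R) (fun=> n%:R).
have mQ n : measurable (Q n : set LT).
  by apply: borel_lebesgue_measurable; exact: measurable_obox.
have muQ n : (mu (Q n) < +oo)%E.
  by apply: lebesgue_tuple_box_lty => // i; rewrite lebesgue_measure_itv/= -EFinB; case: ifP => _; rewrite ltry.
suff Qae n : {ae mu, forall t, Q n t -> (g t)%:E = 0%E}.
  have := ae_foralln Qae; apply: filterS => t tQ.
  apply: EFin_inj; apply: (tQ (\max_j (Num.truncn `|tnth t j|).+1)%N) => j.
  rewrite /= in_itv/= -ltr_norml.
  apply: (@lt_le_trans _ _ (Num.truncn `|tnth t j|).+1%:R); first exact: truncnS_gt.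
  by rewrite ler_nat; exact: (leq_bigmax_cond (P := xpredT) j).
have borel0 (B : set T) : measurable B -> (\int[mu]_(t in B `&` Q n) (g t)%:E = 0)%E.
  rewrite measurable_oboxes; move: B; apply: dynkin_induction.
  - exact: measurable_oboxes.
  - exact: oboxes_setI.
  - by rewrite setTI; exact: g0.
  - move=> _ [a [b ->]]; have [||a' [b' ->]] := @oboxes_setI (obox a b) (Q n) _ _.
    + by exists a, b.
    + by exists (fun=> - n%:R), (fun=> n%:R).
    + exact: g0.
  - move=> S mS S0; have mS' : measurable (S : set LT) by exact: borel_lebesgue_measurable.
    have QE : (S `&` Q n) `|` (~` S `&` Q n) = Q n.
      by rewrite -setIUl setUv setTI.
    have m1 : measurable (S `&` Q n : set LT) by exact: measurableI.
    have m2 : measurable (~` S `&` Q n : set LT).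
      by apply: measurableI => //; exact: measurableC.
    have mg : measurable_fun ((S `&` Q n) `|` (~` S `&` Q n) : set LT) (fun t => (g t)%:E).
      by rewrite QE; exact: measurable_int (gint n).
    have disj : [disjoint (S `&` Q n) & (~` S `&` Q n)].
      by apply/disj_setPS => t [[St _] [nSt _]].
    have := integral_setU mu m1 m2 mg disj.
    by rewrite QE S0 add0e => <-; exact: g0.
  - move=> F mF tF F0; rewrite setI_bigcupl integral_bigcup.
    + by apply: eseries0 => k _ _; exact: F0.
    + have /trivIsetP tF' := tF; apply/trivIsetP => i j _ _ ij.
      by rewrite setIACA tF'// set0I.
    + by move=> k; apply: measurableI => //; apply: borel_lebesgue_measurable; exact: mF.
    + apply: (integrableS (mQ n) _ _ (gint n)); last by move=> t [k _ []].
      apply: bigcup_measurable => k _; apply: measurableI => //.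
      by apply: borel_lebesgue_measurable; exact: mF.
apply: (integral_ae_eq (mQ n) (gint n)) => //.
move=> E EQ mE; rewrite integral0.
have Eoo : (mu E < +oo)%E.
  by apply: le_lt_trans (muQ n); apply: le_measure; rewrite ?inE.
have [B [mB EB B0]] := completed_outer_borel Eoo mE.
have mB' : measurable (B : set LT) by exact: borel_lebesgue_measurable.
(* E differs by a null set from a bounded Borel set *)
have EE : E = (B `&` Q n) `\` (B `\` E).
  apply/seteqP; split=> [t Et|t [[Bt Qt] nBE]].
    by split; [split; [exact: EB|exact: EQ]|case].
  by apply: contrapT => nE; apply: nBE.
rewrite [X in integral _ X]EE -negligible_integral ?borel0//.
- exact: measurableD.
- exact: measurableI.
- apply: (integrableS (mQ n) _ _ (gint n)); last by move=> t [].
  exact: measurableI.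
Qed.
End vanishing_on_boxes.

(** * Smooth bumps *)

Section flat.
Context {R : realType}.

(** The function t^-j exp(-1/t), extended by 0 to t <= 0. The family, unlike its member
    of index 0, is closed under derivation up to linear combinations. *)
Definition flat (j : nat) (t : R) : R := if 0 < t then t^-1 ^+ j * expR (- t^-1) else 0.

Lemma flat_ge0 j t : 0 <= flat j t.
Proof.
by rewrite /flat; case: ifP => // t0; rewrite mulr_ge0 ?expR_ge0// exprn_ge0// invr_ge0 ltW.
Qed.

Lemma flat0_le1 t : flat 0 t <= 1.
Proof.
rewrite /flat; case: ifP => // t0; rewrite expr0 mul1r expR_le1.
by rewrite oppr_le0 invr_ge0 ltW.
Qed.

(** With [flatS] it shows that the difference quotients of [flat j] at 0 tend to 0. It
    comes from the term of degree j.+1 of the series of exp(1/t). *)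
Lemma flat_le j t : flat j t <= j.+1`!%:R * `|t|.
Proof.
rewrite /flat; case: ifP => t0; last by rewrite mulr_ge0.
rewrite gtr0_norm// expRN ler_pdivrMr ?expR_gt0//.
have u0 : 0 <= t^-1 by rewrite invr_ge0 ltW.
have : t^-1 ^+ j.+1 / j.+1`!%:R <= expR t^-1.
  by apply: le_trans (expR_ge1Dxn j u0); rewrite lerDr.
rewrite ler_pdivrMr ?ltr0n ?fact_gt0// => /(ler_wpM2l (ltW t0)).
rewrite exprS mulrA mulfV ?gt_eqF// mul1r => h.
by rewrite (le_trans h)// mulrCA mulrC [t * _]mulrC.
Qed.

Lemma flatS j t : flat j t = t * flat j.+1 t.
Proof.
rewrite /flat; case: ifP => t0; last by rewrite mulr0.
by rewrite exprS !mulrA mulfV ?gt_eqF// mul1r.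
Qed.

Lemma is_derive_inv (t : R) : t != 0 -> is_derive t 1 (fun s : R => s^-1) (- t^-1 ^+ 2).
Proof.
move=> t0; apply: DeriveDef; first by apply: (@derivableV _ _ id).
have -> := @deriveV _ _ id t 1 t0 (@derivable_id _ _ _ _).
by rewrite derive_id exprVn /GRing.scale/= mulr1.
Qed.

Lemma is_derive_flat j (t : R) :
  is_derive t 1 (flat j) (flat j.+2 t - j%:R * flat j.+1 t).
Proof.
have [t0|t0|->] := ltgtP t 0.
- rewrite /flat !(ltNge 0) (ltW t0)/= mulr0 subr0.
  apply: (near_eq_is_derive _ (is_derive_cst (0 : R) t 1)).
  near=> s; rewrite ifN// -leNgt ltW//; near: s.
  exact: lt_nbhsl.
- have t1 := lt0r_neq0 t0.
  have dI := is_derive_inv t1.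
  have dE : is_derive t 1 (fun s : R => expR (- s^-1)) (t^-1 ^+ 2 * expR (- t^-1)).
    have := @is_derive1_comp _ expR (fun s : R => - s^-1) t _ _ (is_derive_expR _) (is_deriveN dI).
    by rewrite opprK mulrC.
  have dM := is_deriveM (is_deriveX j dI) dE.
  have dM' : is_derive t 1 (fun s : R => s^-1 ^+ j * expR (- s^-1))
      (flat j.+2 t - j%:R * flat j.+1 t).
    rewrite (_ : (fun s : R => _) = (fun s : R => s^-1) ^+ j * (fun s : R => expR (- s^-1))).
      apply: (is_derive_eq dM); rewrite !exprfctE /flat t0 /GRing.scale/= !exprS.
      by case: (j) => [|k]; rewrite ?mulr0n ?mul0r ?scale0r /= ?exprS; ring.
    by apply/funext => s; rewrite exprfctE.
  apply: (near_eq_is_derive _ dM').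
  near=> s; rewrite /flat ifT//; near: s; exact: lt_nbhsr.
- rewrite /flat !ltxx mulr0 subr0.
  have lim0 : h^-1 *: ((flat j \o shift 0) (h *: 1) - flat j 0) @[h --> 0^'] --> 0.
    apply/cvgrPdist_le => e e0; near=> h.
    have h0 : h != 0 by near: h; exact: nbhs_dnbhs_neq.
    rewrite /= sub0r normrN [h *: 1]mulr1 addr0 {2}/flat ltxx subr0 flatS.
    rewrite /GRing.scale/= mulrA mulVf// mul1r ger0_norm ?flat_ge0//.
    apply: le_trans (flat_le _ _) _.
    rewrite mulrC -ler_pdivlMr ?ltr0n ?fact_gt0//.
    near: h; apply: dnbhs0_le; by rewrite divr_gt0// ltr0n fact_gt0.
  apply: DeriveDef; last by apply: cvg_lim.
  by apply/cvg_ex; exists 0.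
Unshelve. all: by end_near. Qed.
End flat.

Section flat_functions.
Context {R : realType} {d : nat}.
Notation V := 'cV[R]_d.

(** The algebra generated by flat functions of affine functions of one coordinate. It is
    stable by partial derivatives, and smoothness follows by coinduction. *)
Inductive flat_alg : (V -> R) -> Prop :=
| flat_alg_flat j i (a b : R) : flat_alg (fun x => flat j (a * x i 0 + b))
| flat_alg_cst (c : R) : flat_alg (cst c)
| flat_alg_mul g h : flat_alg g -> flat_alg h -> flat_alg (g * h)
| flat_alg_lin (c : R) g h : flat_alg g -> flat_alg h -> flat_alg (c *: g + h).

Lemma derive_coord i (x v : V) : 'D_v (fun y : V => y i 0) x = v i 0.
Proof.
apply: cvg_lim => //; apply: cvg_near_cst; near=> h.
have h0 : h != 0 by near: h; exact: nbhs_dnbhs_neq.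
by rewrite /= !mxE addrK /GRing.scale/= mulrA mulVf// mul1r.
Unshelve. all: by end_near. Qed.

Lemma differentiable_affine i (a b : R) (x : V) :
  differentiable (fun y : V => a * y i 0 + b) x.
Proof.
apply: (@differentiableD _ _ _ (a *: (fun y : V => y i 0)) (cst b)).
  by apply: differentiableZ; exact: differentiable_coord.
exact: differentiable_cst.
Qed.

Lemma derive_affine i (a b : R) (x v : V) :
  'D_v (fun y : V => a * y i 0 + b) x = a * v i 0.
Proof.
have dc : derivable (fun y : V => y i 0) x v.
  exact/diff_derivable/differentiable_coord.
rewrite (@deriveD _ _ _ (a *: (fun y : V => y i 0)) (cst b)).
- by rewrite deriveZ// derive_coord derive_cst addr0.
- exact: derivableZ.
- exact: derivable_cst.
Qed.

Lemma differentiable_flat j (t : R) : differentiable (flat j : R -> R) t.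
Proof. by apply/derivable1_diffP; have [] := is_derive_flat j t. Qed.

Lemma derive_flat_affine j i (a b : R) (x v : V) :
  'D_v (fun y : V => flat j (a * y i 0 + b)) x =
  (a * v i 0) * (flat j.+2 (a * x i 0 + b) - j%:R * flat j.+1 (a * x i 0 + b)).
Proof.
pose l y := a * (y : V) i 0 + b.
have dl := differentiable_affine i a b x.
have df := differentiable_flat j (l x).
rewrite deriveE; last exact: (@differentiable_comp _ _ _ _ l (flat j)).
rewrite (@diff_comp _ _ _ _ l (flat j))//= diff1E// -deriveE// derive_affine.
congr (_ * _); rewrite derive1E; by have [_ ->] := is_derive_flat j (l x).
Qed.

Lemma flat_alg_smooth g : flat_alg g -> smooth g.
Proof.
apply: smooth_coind => {}g; elim=> [j i a b|c|{}g h ag [dg sg] ah [dh sh]|c {}g h ag [dg sg] ah [dh sh]].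
- split=> [x|l].
    apply: (@differentiable_comp _ _ _ _ (fun y : V => a * y i 0 + b) (flat j)).
      exact: differentiable_affine.
    exact: differentiable_flat.
  pose c : R := a * (delta_mx l 0 : V) i 0.
  rewrite [X in flat_alg X](_ : _ = c *: (fun x : V => flat j.+2 (a * x i 0 + b)) +
      ((- (c * j%:R)) *: (fun x : V => flat j.+1 (a * x i 0 + b)) + cst 0)).
    by do 2![apply: flat_alg_lin; first exact: flat_alg_flat]; exact: flat_alg_cst.
  apply/funext => x; rewrite derive_flat_affine -/c !fctE /GRing.scale/=; ring.
- split=> [x|l]; first exact: differentiable_cst.
  rewrite [X in flat_alg X](_ : _ = cst 0); first exact: flat_alg_cst.
  by apply/funext => x; rewrite derive_cst.
- split=> [x|l]; first exact: differentiableM.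
  rewrite [X in flat_alg X](_ : _ = 1 *: (g * 'D_(delta_mx l 0) h) + h * 'D_(delta_mx l 0) g).
    by apply: flat_alg_lin; apply: flat_alg_mul.
  apply/funext => x; rewrite deriveM; try exact: diff_derivable.
  by rewrite scale1r !fctE.
- split=> [x|l]; first exact/differentiableD/dh/differentiableZ.
  rewrite [X in flat_alg X](_ : _ = c *: 'D_(delta_mx l 0) g + 'D_(delta_mx l 0) h).
    exact: flat_alg_lin.
  apply/funext => x; rewrite deriveD; [|exact/derivableZ/diff_derivable|exact: diff_derivable].
  by rewrite deriveZ//; exact: diff_derivable.
Qed.

Lemma flat_alg_prod (I : Type) (r : seq I) (g : I -> V -> R) :
  (forall i, flat_alg (g i)) -> flat_alg (fun x => \prod_(i <- r) g i x).
Proof.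
move=> ag; elim: r => [|i r IHr].
  rewrite [X in flat_alg X](_ : _ = cst 1); first exact: flat_alg_cst.
  by apply/funext => x; rewrite big_nil.
rewrite [X in flat_alg X](_ : _ = g i * (fun x => \prod_(i <- r) g i x)).
  exact: flat_alg_mul.
by apply/funext => x; rewrite big_cons.
Qed.

Definition box_bump (k : R) (a b : 'I_d -> R) (x : V) : R :=
  \prod_i (flat 0 (k * (x i 0 - a i)) * flat 0 (k * (b i - x i 0))).

Lemma smooth_bump k a b : smooth (box_bump k a b).
Proof.
apply: flat_alg_smooth; apply: flat_alg_prod => i.
rewrite [X in flat_alg X](_ : _ = (fun x : V => flat 0 (k * x i 0 + - (k * a i))) *
    (fun x : V => flat 0 ((- k) * x i 0 + k * b i))).
  by apply: flat_alg_mul; exact: flat_alg_flat.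
by apply/funext => x; rewrite !fctE; congr (flat _ _ * flat _ _); ring.
Qed.

Lemma bump_ge0 k a b x : 0 <= box_bump k a b x.
Proof. by apply: prodr_ge0 => i _; rewrite mulr_ge0// flat_ge0. Qed.

Lemma bump_le1 k a b x : box_bump k a b x <= 1.
Proof.
apply: prodr_ile1 => i _; rewrite mulr_ge0 ?flat_ge0//=.
by rewrite mulr_ile1// ?flat_ge0 ?flat0_le1.
Qed.

Lemma bump_out k a b x : 0 < k -> box_bump k a b x != 0 ->
  forall i, a i < x i 0 < b i.
Proof.
move=> k0 /prodf_neq0 h i; have := h i isT; rewrite mulf_eq0 negb_or /flat.
case: ifP => [|_]; last by rewrite eqxx.
case: ifP => [|_]; last by rewrite eqxx andbF.
by rewrite !pmulr_rgt0// !subr_gt0 => -> ->.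
Qed.

End flat_functions.

(** * Test functions determine locally integrable functions *)

Section du_bois_reymond.
Context {R : realType} {d : nat}.
Notation V := 'cV[R]_d.
Notation mR := (measurableTypeR R).
Notation T := (d.-tuple mR).
Notation LT := (caratheodory_type (mu_ext (borel_lebesgue (R:=R) d))).
Notation mu := (lebesgue (R:=R) d).

Definition locally_rintegrable (g : V -> R) := forall K : set V, compact K ->
  mu.-integrable (vec @^-1` K) (fun t => (g (vec t))%:E).

(** Inside the box each factor is exp(-1/(k s)) for some fixed s > 0. *)
Lemma bump_cvg1 (a b : 'I_d -> R) (x : V) : (forall i, a i < x i 0 < b i) ->
  box_bump k.+1%:R a b x @[k --> \oo] --> (1 : R).
Proof.
move=> xab.
have flat1 (s : R) : 0 < s -> flat 0 (k.+1%:R * s) @[k --> \oo] --> (1 : R).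
  move=> s0; rewrite (_ : (fun k : nat => _) = (fun k => expR (- (harmonic k / s)))).
    have h0 : (fun k => - (harmonic k / s)) @ \oo --> (0 : R).
      rewrite -oppr0 -(mul0r (s^-1)).
      by apply: cvgN; apply: cvgMl; exact: cvg_harmonic.
    have := @continuous_cvg nat _ _ \oo _ _ expR 0 (@continuous_expR R 0) h0.
    by rewrite expR0 => h; exact: h.
  by apply/funext => k; rewrite /flat pmulr_rgt0// s0 expr0 mul1r invfM.
have := @cvg_big R _ _ 1 xpredT (@mul_continuous R) nat \oo (index_enum 'I_d)
  (fun i k => flat 0 (k.+1%:R * (x i 0 - a i)) * flat 0 (k.+1%:R * (b i - x i 0)))
  (fun=> 1 * 1) _.
rewrite [X in _ --> X](_ : _ = 1); last by rewrite big1// => i _; rewrite mul1r.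
apply=> i _; have /andP[ax xb] := xab i.
by apply: cvgM; apply: flat1; rewrite subr_gt0.
Qed.

Lemma measurable_bump k a b :
  measurable_fun [set: LT] (fun t : LT => box_bump k a b (vec t)).
Proof.
apply: completed_measurable_fun; apply: measurable_continuous_vec => x.
exact/differentiable_continuous/(smooth_bump k a b [::]).
Qed.

Lemma obox_sub (a b : 'I_d -> R) :
  obox a b `<=` vec @^-1` [set x : V | forall i, a i <= x i 0 <= b i].
Proof.
by move=> t tab i; have := tab i; rewrite /= in_itv/= mxE => /andP[/ltW-> /ltW->].
Qed.

Lemma measurable_boxV (a b : 'I_d -> R) :
  measurable (vec @^-1` [set x : V | forall i, a i <= x i 0 <= b i] : set LT).
Proof.
apply: borel_lebesgue_measurable.
rewrite (_ : _ @^-1` _ = tuple_box (fun i => `[a i, b i]%classic)).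
  exact: measurable_tuple_box.
by apply/seteqP; split=> t tab i; have := tab i; rewrite /= in_itv/= mxE.
Qed.

Lemma integrable_obox g a b : locally_rintegrable g ->
  mu.-integrable (obox a b) (fun t => (g (vec t))%:E).
Proof.
move=> /(_ _ (@compact_box R d a b)) gi; apply: (integrableS _ _ _ gi).
- exact: measurable_boxV.
- by apply: borel_lebesgue_measurable; exact: measurable_obox.
- exact: obox_sub.
Qed.

Lemma bump_integral_cvg g a b : locally_rintegrable g ->
  (\int[mu]_t (g (vec t) * box_bump k.+1%:R a b (vec t))%:E)%E @[k --> \oo] -->
  (\int[mu]_(t in obox a b) (g (vec t))%:E)%E.
Proof.
move=> lg; have gi := integrable_obox a b lg.
have mg := measurable_int _ gi.
have mD : measurable (obox a b : set LT).
  by apply: borel_lebesgue_measurable; exact: measurable_obox.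
rewrite (_ : (fun k => _) = (fun k => (\int[mu]_(t in obox a b)
    (g (vec t) * box_bump k.+1%:R a b (vec t))%:E)%E)); last first.
  apply/funext => k; rewrite [RHS]integral_mkcond; apply: eq_integral => t _.
  rewrite patchE; case: ifPn => // tab; congr (_%:E).
  apply/eqP; rewrite mulf_eq0; apply/orP; right; apply: contraNT tab.
  move=> /bump_out h; rewrite inE => i; rewrite /= in_itv/=.
  by have := h _ i; rewrite mxE; apply.
have [] := @dominated_convergence _ LT R mu (obox a b) mD
  (fun k t => (g (vec t) * box_bump k.+1%:R a b (vec t))%:E)
  (fun t => (g (vec t))%:E) (fun t => `|(g (vec t))%:E|%E) _ mg _ (integrable_abse gi) _.
- move=> k; apply/measurable_EFinP; apply: measurable_funM.
    by apply/measurable_EFinP.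
  by apply: measurable_funS (measurable_bump _ _ _).
- apply: aeW => t tab; apply: cvg_EFin; first exact: nearW.
  rewrite -[X in _ --> X]mulr1; apply: cvgMr; apply: bump_cvg1 => i.
  by have := tab i; rewrite /= in_itv/= mxE.
- apply: aeW => t k _; rewrite !abse_EFin lee_fin normrM ler_piMr//.
  by rewrite ger0_norm ?bump_ge0 ?bump_le1.
- by move=> ? _ ?.
Qed.

(** As k grows the bumps of parameter k increase to the indicator of the open box; by
    dominated convergence g1 and g2 have the same integral on every open box. *)
Lemma du_bois_reymond g1 g2 : locally_rintegrable g1 -> locally_rintegrable g2 ->
  (forall k a b, 0 < k -> \int[mu]_t (g1 (vec t) * box_bump k a b (vec t)) =
     \int[mu]_t (g2 (vec t) * box_bump k a b (vec t))) ->
  {ae mu, forall t, g1 (vec t) = g2 (vec t)}.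
Proof.
move=> l1 l2 g12.
have mD a b : measurable (obox a b : set LT).
  by apply: borel_lebesgue_measurable; exact: measurable_obox.
have fin g a b : locally_rintegrable g -> (\int[mu]_(t in obox a b) (g (vec t))%:E)%E \is a fin_num.
  by move=> lg; apply: integrable_fin_num => //; exact: integrable_obox.
have lim g a b : locally_rintegrable g ->
    \int[mu]_t (g (vec t) * box_bump k.+1%:R a b (vec t)) @[k --> \oo] -->
    fine (\int[mu]_(t in obox a b) (g (vec t))%:E)%E.
  move=> lg; have := @bump_integral_cvg g a b lg; rewrite -[X in _ --> X -> _]fineK ?fin//.
  by move/fine_cvg.
suff [N [mN N0 sN]] : {ae mu, forall t, g1 (vec t) - g2 (vec t) = 0}.
  exists N; split => //; apply: subset_trans sN => t /= ne eq0; apply: ne.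
  by apply/eqP; rewrite -subr_eq0; exact/eqP.
apply: (@ae_eq0_boxes _ _ (fun t => g1 (vec t) - g2 (vec t))).
  move=> n; have := integrableB (mD _ _) (integrable_obox (fun=> - n%:R) (fun=> n%:R) l1)
    (integrable_obox (fun=> - n%:R) (fun=> n%:R) l2).
  exact.
move=> a b; under eq_integral do rewrite EFinB.
rewrite integralB//; [|exact: integrable_obox|exact: integrable_obox].
rewrite -(fineK (fin _ a b l1)) -(fineK (fin _ a b l2)).
rewrite (_ : fine _ = fine (\int[mu]_(t in obox a b) (g2 (vec t))%:E)%E) ?subee//.
apply: (cvg_unique _ (lim g1 a b l1)) => //.
rewrite (_ : (fun k : nat => _) =
    (fun k : nat => \int[mu]_t (g2 (vec t) * box_bump k.+1%:R a b (vec t)))).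
  exact: lim.
by apply/funext => k; exact: g12.
Qed.

(** If g1 and g2 differ at x they differ on a box around x, which has positive
    measure. *)
Lemma continuous_ae_eq (g1 g2 : V -> R) : continuous g1 -> continuous g2 ->
  {ae mu, forall t, g1 (vec t) = g2 (vec t)} -> g1 = g2.
Proof.
move=> c1 c2 [N [mN N0 sN]]; apply/funext => x; apply: contrapT => ne.
have cB : {for x, continuous (fun x => g1 x - g2 x)}.
  by apply: (@continuousB _ R^o); [exact: c1|exact: c2].
have : \forall y \near x, g1 y - g2 y != 0.
  apply: (cB [set y | y != 0]); apply: open_nbhs_nbhs; split; first exact: open_neq.
  by move=> /=; rewrite subr_eq0; exact/eqP.
move=> /nbhs_ballP[e /= e0 xe].
pose B : set T := obox (fun i => x i 0 - e) (fun i => x i 0 + e).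
have mB : measurable (B : set LT) by apply: borel_lebesgue_measurable; exact: measurable_obox.
have BN : B `<=` N.
  move=> t tB; apply: sN => /= g12; have /xe : ball x e (vec t).
    split=> // i j; rewrite (ord1 j) /ball/= mxE.
    by have := tB i; rewrite /= in_itv/= ltr_distlC.
  by rewrite /= g12 subrr eqxx.
have : (mu B <= 0)%E by rewrite -N0; apply: le_measure; rewrite ?inE.
rewrite leNgt => /negP; apply; rewrite [ltRHS]lebesgueE; last exact: measurable_obox.
rewrite borel_lebesgue_box//.
under eq_bigr => i _.
  rewrite lebesgue_measure_itv/= lte_fin ltrBlDr -addrA ltrDl addr_gt0// -EFinB.
  rewrite (_ : x i 0 + e - (x i 0 - e) = e + e); last by ring.
  over.
by rewrite prodEFin lte_fin prodr_const exprn_gt0// addr_gt0.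
Qed.

End du_bois_reymond.

(** * Interpolation of derivatives and small test functions *)

Section interpolation.
Context {R : realType} {d : nat}.
Notation V := 'cV[R]_d.
Notation E i := (delta_mx i 0 : V).
Implicit Types g : V -> R.

Lemma is_derive_line g x v (t : R) : derivable g (x + t *: v) v ->
  is_derive t 1 (fun s => g (x + s *: v)) ('D_v g (x + t *: v)).
Proof.
have lineE : (fun h : R => h^-1 *: (((fun s => g (x + s *: v)) \o shift t) (h *: 1) - g (x + t *: v))) =
    (fun h : R => h^-1 *: ((g \o shift (x + t *: v)) (h *: v) - g (x + t *: v))).
  apply/funext => h /=; rewrite [h *: 1]mulr1 scalerDl.
  by rewrite [x + (_ + _)]addrCA.
by move=> dg; apply: DeriveDef; rewrite /derivable ?/derive lineE.
Qed.

Lemma mean_value_line g x v (t : R) : (forall y, differentiable g y) -> 0 < t ->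
  exists2 s : R, 0 < s < t & g (x + t *: v) - g x = t * 'D_v g (x + s *: v).
Proof.
move=> dg t0.
have dl (s : R) : is_derive s 1 (fun s => g (x + s *: v)) ('D_v g (x + s *: v)).
  by apply: is_derive_line; exact: diff_derivable.
have [|s] := MVT t0 (fun s _ => dl s).
  apply: derivable_within_continuous => s _.
  by have [] := dl s.
rewrite in_itv/= scale0r addr0 subr0 => s0t ->.
by exists s => //; rewrite mulrC.
Qed.

(** By the mean value theorem, a function h with |h| <= dl whose second derivatives
    are bounded by M has a first derivative bounded by 2 dl / t + M t, for every
    t > 0. Choosing t and then dl makes this small; iterate on the order of
    derivation. The bounds C on all derivatives are fixed in advance, so dl depends on
    C, n and e only. *)
Lemma smooth_interpolation n (C : nat -> R) (e : R) : 0 < e ->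
  exists2 dl, 0 < dl & forall g, smooth g ->
    (forall s x, `|pderiv s g x| <= C (size s)) -> (forall x, `|g x| <= dl) ->
    forall s x, (size s <= n)%N -> `|pderiv s g x| <= e.
Proof.
elim: n e => [|n IHn] e e0.
  by exists e => // g sg gC ge s x; rewrite leqn0 size_eq0 => /eqP ->; exact: ge.
(* M bounds the derivatives of order at most n.+2; t makes the second order term
   M t equal to e / 2, and e t / 4 makes the first order term equal to e / 2 *)
pose M := 1 + \sum_(k < n.+3) `|C k|.
have M0 : 0 < M by rewrite ltr_wpDr// sumr_ge0.
pose t := e / (2 * M).
have t0 : 0 < t by rewrite divr_gt0// mulr_gt0.
have [|dl dl0 dlP] := IHn (Num.min e (e * t / 4)).
  by rewrite lt_min e0 divr_gt0// mulr_gt0.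
exists dl => // g sg gC gdl [|i s] x.
  by move=> _; apply: le_trans (dlP g sg gC gdl [::] x isT) _; rewrite ge_min lexx.
rewrite /= ltnS => sn; pose h := pderiv s g.
have hb y : `|h y| <= e * t / 4.
  by apply: le_trans (dlP g sg gC gdl s y sn) _; rewrite ge_min lexx orbT.
have CM : C (size s).+2 <= M.
  apply: le_trans (ler_norm _) _.
  have sn3 : ((size s).+2 < n.+3)%N by rewrite !ltnS.
  by rewrite /M (bigD1 (Ordinal sn3))//= addrCA lerDl addr_ge0 ?sumr_ge0.
have dh y : differentiable h y by exact: sg.
have dDh y : differentiable ('D_(E i) h) y by exact: (sg (i :: s)).
have [r /andP[r0 rt] hr] := mean_value_line x (E i) dh t0.
have [q _ Dhq] := mean_value_line x (E i) dDh r0.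
have D1 : `|'D_(E i) h (x + r *: E i)| <= e / 2.
  rewrite -(ler_pM2l t0) -[X in X * `|_|](gtr0_norm t0) -normrM -hr.
  apply: le_trans (ler_normB _ _) _; apply: le_trans (lerD (hb _) (hb _)) _.
  lra.
have D2 : `|'D_(E i) h (x + r *: E i) - 'D_(E i) h x| <= e / 2.
  rewrite Dhq normrM gtr0_norm//; apply: (@le_trans _ _ (t * M)).
    apply: ler_pM => //; [exact: ltW|exact: ltW|].
    exact: le_trans (gC (i :: i :: s) _) CM.
  by rewrite /t le_eqVlt; apply/orP; left; apply/eqP; field; exact: lt0r_neq0.
rewrite -[X in `|X|](subKr ('D_(E i) h (x + r *: E i))).
by apply: le_trans (ler_normB _ _) _; lra.
Qed.

Lemma smooth_lipschitz g (C r : R) (x y : V) : smooth g ->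
  (forall i (z : V), `|'D_(E i) g z| <= C) -> (forall i, `|y i 0 - x i 0| <= r) ->
  `|g y - g x| <= d%:R * (r * C).
Proof.
move=> sg gC yx; pose v := y - x.
have dg z : differentiable g z by exact: (sg [::]).
have xv : x + v = y by rewrite /v addrC subrK.
have [s _] := mean_value_line x v dg ltr01.
rewrite scale1r mul1r xv => ->.
rewrite deriveE// [v in 'd _ _ v]matrix_sum_delta.
under eq_bigr do rewrite big_ord1.
rewrite linear_sum; apply: le_trans (ler_norm_sum _ _ _) _.
rewrite -[d in d%:R]card_ord mulr_natl -sumr_const; apply: ler_sum => i _.
rewrite linearZ/= normrM -deriveE//; apply: ler_pM => //.
by have := yx i; rewrite !mxE.
Qed.

End interpolation.

Section test_functions_calculus.
Context {R : realType} {d : nat}.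
Notation V := 'cV[R]_d.
Notation E i := (delta_mx i 0 : V).
Notation D := (test_fun R d).
Implicit Types (g : V -> R) (u v : D).

Lemma pderiv_shift s g h x : pderiv s (fun y => g (y + h)) x = pderiv s g (x + h).
Proof.
elim: s x => //= i s IHs x; rewrite (_ : pderiv s (fun y => _) = (fun y => pderiv s g (y + h))).
  move: (pderiv s g) => k; rewrite /derive; congr (lim _).
  have -> : (fun t : R => t^-1 *: (((fun y => k (y + h)) \o shift x) (t *: E i) - k (x + h))) =
      (fun t : R => t^-1 *: ((k \o shift (x + h)) (t *: E i) - k (x + h))).
    by apply/funext => t; rewrite /= addrA.
  by [].
by apply/funext.
Qed.

Lemma pderiv_supp s g (K : set V) : closed K -> (forall x, ~ K x -> g x = 0) ->
  forall x, ~ K x -> pderiv s g x = 0.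
Proof.
move=> cK gK; elim: s => //= i s IHs x nK.
rewrite (_ : 0 = 'D_(E i) (cst (0 : R)) x); last by rewrite derive_cst.
apply: near_eq_derive.
have : \forall y \near x, (~` K) y.
  by apply: open_nbhs_nbhs; split => //; exact: closed_openC.
by apply: filterS => y /IHs ->.
Qed.

Lemma cpderiv_shift s h u x : cpderiv s (test_shift h u) x = cpderiv s u (x + h).
Proof.
rewrite /cpderiv; congr (_ +i* _).
  exact: (pderiv_shift s (@complex.Re R \o u)).
exact: (pderiv_shift s (@complex.Im R \o u)).
Qed.

Lemma cpderiv_lin s (a : R[i]) u v x :
  cpderiv s (a *: u + v : D) x = a * cpderiv s u x + cpderiv s v x.
Proof.
have [sr si] := test_csmooth u; have [tr ti] := test_csmooth v.
case: a => ar ai; rewrite /cpderiv.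
have -> : (@complex.Re R \o (((ar +i* ai) *: u + v : D) : V -> R[i]^o)) =
   (fun y => 1 * (ar * (@complex.Re R \o u) y + (- ai) * (@complex.Im R \o u) y) +
             1 * (@complex.Re R \o v) y).
  apply/funext => y /=; rewrite !mul1r mulNr.
  rewrite -[X in complex.Re X]/((ar +i* ai) * u y + v y).
  by case: (u y) => ? ?; case: (v y) => ? ?.
have -> : (@complex.Im R \o (((ar +i* ai) *: u + v : D) : V -> R[i]^o)) =
   (fun y => 1 * (ar * (@complex.Im R \o u) y + ai * (@complex.Re R \o u) y) +
             1 * (@complex.Im R \o v) y).
  apply/funext => y /=; rewrite !mul1r.
  rewrite -[X in complex.Im X]/((ar +i* ai) * u y + v y).
  by case: (u y) => ? ?; case: (v y) => ? ?.
rewrite (pderiv_lin s 1 1 (smooth_lin ar (- ai) sr si) tr) (pderiv_lin s ar (- ai) sr si).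
rewrite (pderiv_lin s 1 1 (smooth_lin ar ai si sr) ti) (pderiv_lin s ar ai si sr).
by apply/eqP; rewrite eq_complex /= !mul1r mulNr !eqxx.
Qed.

Lemma cpderiv_sum s (I : Type) (r : seq I) (a : I -> R[i]) (u : I -> D) x :
  cpderiv s (\sum_(k <- r) a k *: u k : D) x = \sum_(k <- r) a k * cpderiv s (u k) x.
Proof.
have cpd0 : cpderiv s (0 : D) x = 0.
  by have := cpderiv_lin s (-1) 0 0 x; rewrite scaler0 add0r mulN1r addNr.
elim: r => [|k r IHr]; first by rewrite !big_nil.
by rewrite !big_cons cpderiv_lin IHr.
Qed.

Lemma pderiv_bound (K : set V) s g : smooth g -> compact K ->
  (forall x, ~ K x -> g x = 0) -> exists2 C, 0 <= C & forall x, `|pderiv s g x| <= C.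
Proof.
move=> sg cK gK; have clK : closed K by apply: compact_closed => //; exact: norm_hausdorff.
apply: (compact_support_bound cK) => [x|x].
  exact/differentiable_continuous/sg.
by apply: contra_neqP; exact: pderiv_supp.
Qed.

Lemma test_supp u x : ~ tsupp u x -> u x = 0.
Proof. by apply: contra_notP => /eqP; exact: tsuppP. Qed.

(** There are finitely many partial derivatives of each order, so the bound may depend on
    the order alone, as [smooth_interpolation] requires. *)
Lemma test_bound u : exists C : nat -> R, forall s x, `|cpderiv s u x| <= (C (size s))%:C.
Proof.
have [sr si] := test_csmooth u.
have /choice[C CP] : forall s, exists C, 0 <= C /\ forall x, `|cpderiv s u x| <= C%:C.
  move=> s; have [|A A0 AP] := @pderiv_bound (tsupp u) s _ sr (@test_compact _ _ u).
    by move=> x /test_supp /= ->.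
  have [|B B0 BP] := @pderiv_bound (tsupp u) s _ si (@test_compact _ _ u).
    by move=> x /test_supp /= ->.
  exists (A + B); split => [|x]; first exact: addr_ge0.
  apply: le_trans (norm_le_parts _) _; rewrite lecR.
  by apply: lerD; [exact: AP|exact: BP].
exists (fun n => \sum_(t : n.-tuple 'I_d) C t) => s x.
apply: le_trans ((CP s).2 x) _; rewrite lecR (bigD1 (in_tuple s))//= lerDl.
by apply: sumr_ge0 => t _; exact: (CP t).1.
Qed.

Lemma test_lipschitz u (C r : R) (x y : V) :
  (forall i z, `|cpderiv [:: i] u z| <= C%:C) -> (forall i, `|y i 0 - x i 0| <= r) ->
  `|u y - u x| <= (d%:R * (r * C) + d%:R * (r * C))%:C.
Proof.
move=> uC yx; have [sr si] := test_csmooth u.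
apply: le_trans (norm_le_parts _) _; rewrite lecR; apply: lerD.
- rewrite (_ : complex.Re _ = (@complex.Re R \o u) y - (@complex.Re R \o u) x); last first.
    by rewrite /=; case: (u y) => ? ?; case: (u x).
  apply: smooth_lipschitz => // i z.
  by have := le_trans (Re_le_norm _) (uC i z); rewrite lecR.
- rewrite (_ : complex.Im _ = (@complex.Im R \o u) y - (@complex.Im R \o u) x); last first.
    by rewrite /=; case: (u y) => ? ?; case: (u x).
  apply: smooth_lipschitz => // i z.
  by have := le_trans (Im_le_norm _) (uC i z); rewrite lecR.
Qed.

(** Continuity of f at 0 asks for derivatives up to some order to be small on K;
    interpolation obtains this from the smallness of u itself. *)
Lemma distribution_small (f : D -> R[i]^o) (K : set V) (C : nat -> R) (e : R) :
  is_distribution f -> compact K -> 0 < e ->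
  exists2 dl, 0 < dl & forall u : D, tsupp u `<=` K ->
    (forall s x, `|cpderiv s u x| <= (C (size s))%:C) ->
    (forall x, `|u x| <= dl%:C) -> `|f u| <= e%:C.
Proof.
move=> [lf cf] cK e0.
have f0 : f 0 = 0.
  by have := lf (-1) 0 0; rewrite scaler0 add0r scaleN1r addNr.
have [U [Uc Ub UK] Uf] : lf_nbhs (0 : D) [set u | `|f u| < e%:C].
  have := cf 0; rewrite /continuous_at f0 => /cvgr0Pnorm_lt; apply.
  by rewrite ltcR.
have [N [ep [ep0 UN]]] := UK K cK.
have ep2 : 0 < ep / 2 by rewrite divr_gt0.
have [dl dl0 dlP] := @smooth_interpolation R d N C (ep / 2) ep2.
exists dl => // u uK uC udl; have [sr si] := test_csmooth u.
rewrite ltW// -[u]add0r; apply: Uf; apply: UN => // s x sN.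
apply: le_trans (norm_le_parts _) _; rewrite lecR [leRHS]splitr; apply: lerD.
- apply: dlP => // [s' y|y].
    by have := le_trans (Re_le_norm _) (uC s' y); rewrite lecR.
  by have := le_trans (Re_le_norm _) (udl y); rewrite lecR.
- apply: dlP => // [s' y|y].
    by have := le_trans (Im_le_norm _) (uC s' y); rewrite lecR.
  by have := le_trans (Im_le_norm _) (udl y); rewrite lecR.
Qed.

End test_functions_calculus.

Section translates.
Context {R : realType} {d : nat}.
Notation V := 'cV[R]_d.
Notation D := (test_fun R d).
Implicit Types (u v : D) (f : D -> R[i]^o).

Lemma cpderiv_nil u x : cpderiv [::] u x = u x.
Proof. by rewrite /cpderiv /=; case: (u x). Qed.

Lemma test_sup_box u : exists L : nat, forall x, u x != 0 -> sup_box L%:R x.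
Proof.
have [L LP] := compact_sub_sup_box (@test_compact _ _ u).
by exists L => x /tsuppP /LP.
Qed.

Lemma cpderivB s u v x : cpderiv s (u - v : D) x = cpderiv s u x - cpderiv s v x.
Proof. by rewrite -scaleN1r addrC cpderiv_lin mulN1r addrC. Qed.

Lemma complex_gt0 (e : R[i]) : 0 < e -> exists2 r : R, 0 < r & e = r%:C.
Proof. by case: e => a b; rewrite ltcE/= => /andP[/eqP-> a0]; exists a. Qed.

(** Two nearby translates of u differ by a uniformly small function, by Lipschitz
    continuity; its support stays in a fixed box and its derivatives are bounded by
    twice those of u. *)
Lemma translate_continuous f u : is_distribution f ->
  continuous (fun h : V => f (test_shift (- h) u)).
Proof.
move=> df h0; have [lf _] := df.
have [C CP] := test_bound u.
have [L LP] := test_sup_box u.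
pose H := `|h0| + 1.
apply/cvgrPdist_le => [|_ /complex_gt0[e e0 ->]]; first exact: nbhs_filter.
have [dl dl0 dlP] := distribution_small (fun n => C n + C n) df (@compact_sup_box R d (L%:R + H)) e0.
have C1 : 0 <= `|C 1%N| by [].
pose r := Num.min 1 (dl / (2 * (d%:R * `|C 1%N| + 1))).
have dC : 0 < 2 * (d%:R * `|C 1%N| + 1) by rewrite mulr_gt0// ltr_wpDl// mulr_ge0.
have r0 : 0 < r by rewrite lt_min ltr01 divr_gt0.
have rdl : d%:R * (r * `|C 1%N|) + d%:R * (r * `|C 1%N|) <= dl.
  have : r * (2 * (d%:R * `|C 1%N| + 1)) <= dl.
    by rewrite -ler_pdivlMr// ge_min lexx orbT.
  apply: le_trans; rewrite [leRHS](_ : _ = d%:R * (r * `|C 1%N|) + d%:R * (r * `|C 1%N|) + 2 * r).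
    by rewrite lerDl mulr_ge0// ltW.
  by ring.
near=> h.
have hh0 : `|h0 - h| <= r by near: h; exact: cvgr_dist_le.
have hH i : `|h i 0| <= H.
  apply: le_trans (coord_le_norm h i) _; rewrite -[h in `|h|](subKr h0).
  apply: le_trans (ler_normB _ _) _; rewrite lerD// (le_trans hh0)// ge_min lexx.
have h0H i : `|h0 i 0| <= H by rewrite (le_trans (coord_le_norm h0 i))// lerDl.
have fB (v w : D) : f v - f w = f (v - w).
  by rewrite -[v - w]addrC -[- w]scaleN1r lf scaleN1r addrC.
rewrite fB; apply: dlP => [||x].
- apply: tsupp_subset; first exact: compact_sup_box.
  move=> x nz i.
  have [z1|z1] := eqVneq (u (x - h0)) 0; last first.
    have := LP _ z1 i; rewrite !mxE => l; rewrite -[X in `|X|](subrK (h0 i 0)).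
    by rewrite (le_trans (ler_normD _ _))// lerD.
  have [z2|z2] := eqVneq (u (x - h)) 0; last first.
    have := LP _ z2 i; rewrite !mxE => l; rewrite -[X in `|X|](subrK (h i 0)).
    by rewrite (le_trans (ler_normD _ _))// lerD.
  by move: nz; rewrite -[X in X != 0]/(u (x - h0) - u (x - h)) z1 z2 subrr eqxx.
- move=> s x; rewrite cpderivB !cpderiv_shift rmorphD/=.
  by apply: le_trans (ler_normB _ _) _; rewrite lerD.
- rewrite -[X in `|X|]/(u (x - h0) - u (x - h)).
  apply: le_trans (@test_lipschitz _ _ u `|C 1%N| r (x - h) (x - h0) _ _) _.
  + by move=> i z; apply: le_trans (CP [:: i] z) _; rewrite lecR ler_norm.
  + move=> i; have := le_trans (coord_le_norm (h0 - h) i) hh0; rewrite !mxE => hi.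
    rewrite (_ : x i 0 - h0 i 0 - (x i 0 - h i 0) = h i 0 - h0 i 0); last by ring.
    by rewrite distrC.
  + by rewrite lecR.
Unshelve. all: by end_near. Qed.

End translates.

(** * Discrete convolutions and the exchange identity *)

Section lattice_convolution.
Context {R : realType} {d : nat}.
Notation V := 'cV[R]_d.
Notation D := (test_fun R d).

Variable L : nat.
Implicit Types u v : D.

(** For v supported in the box of radius L, the Riemann sum of step 1 / m.+1 of the
    convolution of u and v. It is a finite linear combination of translates of u,
    hence a test function to which f applies term by term. *)
Definition discrete_conv m u v : D :=
  \sum_n ((m.+1%:R ^+ d)^-1%:C * v (mesh_point n)) *: test_shift (- @mesh_point R d L m n) u.

Lemma cpderiv_discrete_conv s m u v x : cpderiv s (discrete_conv m u v) x =
  \sum_n ((m.+1%:R ^+ d)^-1%:C * v (mesh_point n)) * cpderiv s u (x - @mesh_point R d L m n).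
Proof. by rewrite cpderiv_sum; apply: eq_bigr => n _; rewrite cpderiv_shift. Qed.

Lemma discrete_convE m u v x : discrete_conv m u v x =
  \sum_n ((m.+1%:R ^+ d)^-1%:C * v (mesh_point n)) * u (x - @mesh_point R d L m n).
Proof. by rewrite -cpderiv_nil cpderiv_discrete_conv; apply: eq_bigr => n _; rewrite cpderiv_nil. Qed.

Lemma card_mesh m : (#|{ffun 'I_d -> 'I_(mesh L m + mesh L m).+1}|%:R : R) <=
  (L + L).+1%:R ^+ d * m.+1%:R ^+ d.
Proof.
rewrite card_ffun !card_ord natrX -exprMn lerXn2r ?nnegrE ?mulr_ge0//.
by rewrite -natrM ler_nat /mesh; lia.
Qed.

(** Uniform in m: the number of mesh points is at most a constant times the inverse of
    the volume of a grid cube, and derivatives fall on u only. *)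
Lemma cpderiv_discrete_conv_bound u v (A B : nat -> R) :
  (forall s x, `|cpderiv s u x| <= (A (size s))%:C) ->
  (forall s x, `|cpderiv s v x| <= (B (size s))%:C) ->
  forall m s x, `|cpderiv s (discrete_conv m u v) x| <=
    ((L + L).+1%:R ^+ d * (B 0%N * A (size s)))%:C.
Proof.
move=> uA vB m s x; rewrite cpderiv_discrete_conv.
have md : 0 < m.+1%:R ^+ d :> R by rewrite exprn_gt0.
have A0 : 0 <= A (size s) by rewrite -lecR; exact: le_trans (normr_ge0 _) (uA s 0).
have B0 : 0 <= B 0%N by rewrite -lecR; exact: le_trans (normr_ge0 _) (vB [::] 0).
apply: le_trans (ler_norm_sum _ _ _) _.
apply: (@le_trans _ _ (\sum_(n : {ffun 'I_d -> 'I_(mesh L m + mesh L m).+1})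
    ((m.+1%:R ^+ d)^-1 * (B 0%N * A (size s)))%:C)).
  apply: ler_sum => n _; rewrite !normrM -mulrA !rmorphM/=; apply: ler_pM => //.
  - by rewrite normc_def/= expr0n addr0 sqrtr_sqr ger0_norm// invr_ge0 ltW.
  - by apply: ler_pM => //; rewrite -cpderiv_nil; exact: vB.
rewrite sumr_const -rmorphMn lecR; set N := #|_|.
rewrite -[_ *+ N]mulr_natl [N%:R * _]mulrA ler_wpM2r ?mulr_ge0//.
by rewrite ler_pdivrMr//; exact: card_mesh.
Qed.

Lemma discrete_conv_supp m u v : (forall x, u x != 0 -> sup_box L%:R x) ->
  (forall x, v x != 0 -> sup_box L%:R x) ->
  forall x, discrete_conv m u v x != 0 -> sup_box (L%:R + L%:R) x.
Proof.
move=> uL vL x; apply: contra_neqP => nx; rewrite discrete_convE big1// => n _.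
have [->|/vL h1] := eqVneq (v (mesh_point n)) 0; first by rewrite mulr0 mul0r.
have [->|/uL h2] := eqVneq (u (x - mesh_point n)) 0; first by rewrite mulr0.
exfalso; apply: nx => i; rewrite -[X in `|X|](subrK (mesh_point n i 0)).
by rewrite (le_trans (ler_normD _ _))// lerD//; have := h2 i; rewrite !mxE.
Qed.

(** At a point j of the lattice the substitution of j - k for k, which permutes the
    lattice, exchanges u and v. *)
Lemma discrete_conv_lattice m u v j : (forall x, u x != 0 -> sup_box L%:R x) ->
  (forall x, v x != 0 -> sup_box L%:R x) ->
  discrete_conv m u v (lattice m j) = discrete_conv m v u (lattice m j).
Proof.
move=> uL vL; pose c : R[i] := (m.+1%:R ^+ d)^-1%:C.
pose a u v k : R[i] := c * v (lattice m k) * u (lattice m (j - k)).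
have conv_sum u' v' : (forall x, v' x != 0 -> sup_box L%:R x) ->
    discrete_conv m u' v' (lattice m j) = \sum_(k \in [set: 'cV[int]_d]) a u' v' k.
  move=> vL'; rewrite -(@sum_box_points d _ (mesh L m)).
    rewrite discrete_convE; apply: eq_bigr => n _; rewrite /a /mesh_point.
    congr (_ * u' _); apply/colP => i; by rewrite !mxE -mulrBl -intrB.
  move=> k nz; apply: lattice_sup_box; apply: vL'.
  by apply: contra_neq nz => v0; rewrite /a v0 mulr0 mul0r.
rewrite !conv_sum// (reindex_fsbigT (fun k => j - k)).
  apply: eq_fsbigr => k _; rewrite /a subKr -!mulrA; congr (_ * _); exact: mulrC.
by exists (fun k => j - k) => k; rewrite subKr.
Qed.

Lemma distribution_discrete_conv (f : D -> R[i]^o) m u v : linear f ->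
  (forall x, v x != 0 -> sup_box L%:R x) ->
  f (discrete_conv m u v) =
    riemann_sum m (fun x => complex.Re (v x * f (test_shift (- x) u))) +i*
    riemann_sum m (fun x => complex.Im (v x * f (test_shift (- x) u))).
Proof.
move=> lf vL; pose f' : {linear D -> R[i]^o} := HB.pack f (GRing.isLinear.Build _ _ _ _ f lf).
pose H x := v x * f (test_shift (- x) u).
have HL k : H (lattice m k) != 0 -> forall i, `|k i 0| <= (mesh L m)%:Z.
  move=> nz; apply: lattice_sup_box; apply: vL.
  by apply: contra_neq nz => v0; rewrite /H v0 mul0r.
have part (op : R[i] -> R) : op 0 = 0 ->
    riemann_sum m (fun x => op (H x)) = \sum_n (m.+1%:R ^+ d)^-1 * op (H (@mesh_point R d L m n)).
  move=> op0; rewrite /riemann_sum -(@sum_box_points d _ (mesh L m)).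
    by rewrite mulr_sumr.
  by move=> k nz; apply: HL; apply: contra_neq nz => ->.
rewrite (part (@complex.Re R))// (part (@complex.Im R))// -complex_sum.
rewrite -[f _]/(f' _) linear_sum; apply: eq_bigr => n _; rewrite linearZ/=.
rewrite /GRing.scale/= -mulrA -/(H _); case: (H _) => a b.
by apply/eqP; rewrite eq_complex /= !mul0r subr0 addr0 !eqxx.
Qed.

End lattice_convolution.

Section exchange.
Context {R : realType} {d : nat}.
Notation V := 'cV[R]_d.
Notation D := (test_fun R d).
Notation mu := (lebesgue (R:=R) d).

Lemma test_continuous (u : D) : continuous u.
Proof.
have [sr si] := test_csmooth u.
by apply/continuous_parts; split=> x; apply: differentiable_continuous; [exact: (sr [::])|exact: (si [::])].
Qed.

Lemma continuous_mulC (g h : V -> R[i]^o) : continuous g -> continuous h ->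
  continuous (fun x => g x * h x : R[i]^o).
Proof.
move=> /continuous_parts[gr gi] /continuous_parts[hr hi].
apply/continuous_parts; split=> x.
- rewrite (_ : _ \o _ = fun y => (@complex.Re R \o g) y * (@complex.Re R \o h) y -
      (@complex.Im R \o g) y * (@complex.Im R \o h) y).
    by apply: (@continuousB R R^o V (fun y => (@complex.Re R \o g) y * (@complex.Re R \o h) y)
      (fun y => (@complex.Im R \o g) y * (@complex.Im R \o h) y)); apply: continuousM; [exact: gr|exact: hr|exact: gi|exact: hi].
  by apply/funext => y /=; case: (g y) (h y) => ? ? [].
- rewrite (_ : _ \o _ = fun y => (@complex.Re R \o g) y * (@complex.Im R \o h) y +
      (@complex.Im R \o g) y * (@complex.Re R \o h) y).
    by apply: (@continuousD R R^o V (fun y => (@complex.Re R \o g) y * (@complex.Im R \o h) y)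
      (fun y => (@complex.Im R \o g) y * (@complex.Re R \o h) y)); apply: continuousM; [exact: gr|exact: hi|exact: gi|exact: hr].
  by apply/funext => y /=; case: (g y) (h y) => ? ? [].
Qed.

(** The two sums agree on the lattice, and every point is within 1 / m.+1 of it.
    Since the derivatives of the difference are bounded uniformly in m, the difference
    is uniformly small for large m. *)
Lemma discrete_conv_comm (f : D -> R[i]^o) L (u v : D) (e : R) : is_distribution f ->
  (forall x, u x != 0 -> sup_box L%:R x) -> (forall x, v x != 0 -> sup_box L%:R x) ->
  0 < e -> \forall m \near \oo,
    `|f (discrete_conv L m u v) - f (discrete_conv L m v u)| <= e%:C.
Proof.
move=> df uL vL e0; have [lf _] := df.
have [A AP] := test_bound u; have [B BP] := test_bound v.
pose Q : R := (L + L).+1%:R ^+ d.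
pose C n := Q * (B 0%N * A n) + Q * (A 0%N * B n).
have [dl dl0 dlP] := distribution_small C df (@compact_sup_box R d (L%:R + L%:R)) e0.
have fB (w w' : D) : f w - f w' = f (w - w').
  by rewrite -[w - w']addrC -[- w']scaleN1r lf scaleN1r addrC.
pose M := 2 * (d%:R * `|C 1%N|) + 1.
have M0 : 0 < M by rewrite ltr_wpDl// !mulr_ge0.
near=> m; rewrite fB; set G := _ - _ : D.
have GC s x : `|cpderiv s G x| <= (C (size s))%:C.
  rewrite cpderivB; apply: le_trans (ler_normB _ _) _; rewrite rmorphD/=.
  by apply: lerD; apply: cpderiv_discrete_conv_bound.
apply: dlP => // [|x].
  apply: tsupp_subset; first exact: compact_sup_box.
  move=> x nz; have [z1|z1] := eqVneq (discrete_conv L m u v x) 0; last first.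
    exact: discrete_conv_supp z1.
  have [z2|z2] := eqVneq (discrete_conv L m v u x) 0; last first.
    exact: discrete_conv_supp z2.
  move: nz; rewrite -[X in X != 0]/(discrete_conv L m u v x - discrete_conv L m v u x).
  by rewrite z1 z2 subrr eqxx.
have [j xj] := floor_lattice m x.
have Gj : G (lattice m j) = 0.
  rewrite -[LHS]/(discrete_conv L m u v (lattice m j) - discrete_conv L m v u (lattice m j)).
  by rewrite discrete_conv_lattice// subrr.
rewrite -[G x]subr0 -Gj.
apply: le_trans (@test_lipschitz _ _ G `|C 1%N| m.+1%:R^-1 _ _ _ xj) _.
  by move=> i z; apply: le_trans (GC [:: i] z) _; rewrite lecR ler_norm.
have mM : m.+1%:R^-1 <= dl / M.
  by apply/ltW; near: m; apply: (near_infty_natSinv_lt (PosNum (divr_gt0 dl0 M0))).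
rewrite lecR; apply: (@le_trans _ _ (m.+1%:R^-1 * M)); last by rewrite -ler_pdivlMr.
rewrite /M mulrDr mulr1 (_ : d%:R * (_ * _) + _ = m.+1%:R^-1 * (2 * (d%:R * `|C 1%N|))).
  by rewrite lerDl.
by ring.
Unshelve. all: by end_near. Qed.

(** Both sides are f evaluated at the convolution of u and v, obtained as limits of
    f (discrete_conv u v) and f (discrete_conv v u). *)
Lemma convolution_exchange (f : D -> R[i]^o) (u v : D) : is_distribution f ->
  cintegral (fun x => v x * f (test_shift (- x) u)) =
  cintegral (fun x => u x * f (test_shift (- x) v)).
Proof.
move=> df; have [lf _] := df.
have [Lu LuP] := test_sup_box u; have [Lv LvP] := test_sup_box v.
pose L := maxn Lu Lv.
have uL x : u x != 0 -> sup_box L%:R x.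
  by move/LuP; apply: sup_boxS; rewrite ler_nat leq_maxl.
have vL x : v x != 0 -> sup_box L%:R x.
  by move/LvP; apply: sup_boxS; rewrite ler_nat leq_maxr.
pose H (u v : D) x : R[i]^o := v x * f (test_shift (- x) u).
have cH u' v' : continuous (H u' v').
  by apply: continuous_mulC; [exact: test_continuous|exact: translate_continuous].
have HL (u' v' : D) (op : R[i] -> R) : (forall x, v' x != 0 -> sup_box L%:R x) ->
    op 0 = 0 -> forall x, op (H u' v' x) != 0 -> sup_box L%:R x.
  by move=> v'L op0 x nz; apply: v'L; apply: contra_neq nz => z; rewrite /H z mul0r.
have part (op : R[i] -> R) : op 0 = 0 ->
    (forall u v, continuous (op \o H u v)) ->
    (forall e : R, 0 < e -> \forall m \near \oo,
      `|riemann_sum m (op \o H u v) - riemann_sum m (op \o H v u)| <= e) ->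
    \int[mu]_t op (H u v (vec t)) = \int[mu]_t op (H v u (vec t)).
  move=> op0 cop small; apply/eqP; rewrite -subr_eq0; apply/eqP.
  have c1 := riemann_sum_cvg (cop u v) (HL u v op vL op0).
  have c2 := riemann_sum_cvg (cop v u) (HL v u op uL op0).
  apply: (cvg_unique _ (cvgB c1 c2)) => //.
  apply/cvgrPdist_le => e e0; have := small e e0; apply: filterS => m.
  by rewrite sub0r normrN.
have fsum m : f (discrete_conv L m u v) - f (discrete_conv L m v u) =
   (riemann_sum m (@complex.Re R \o H u v) - riemann_sum m (@complex.Re R \o H v u)) +i*
   (riemann_sum m (@complex.Im R \o H u v) - riemann_sum m (@complex.Im R \o H v u)).
  by rewrite !distribution_discrete_conv.
rewrite /cintegral; congr (_ +i* _); apply: part => //.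
- by move=> u' v'; have /continuous_parts[] := cH u' v'.
- move=> e /(discrete_conv_comm df uL vL); apply: filterS => m.
  by rewrite fsum => /(le_trans (Re_le_norm _)); rewrite lecR.
- by move=> u' v'; have /continuous_parts[] := cH u' v'.
- move=> e /(discrete_conv_comm df uL vL); apply: filterS => m.
  by rewrite fsum => /(le_trans (Im_le_norm _)); rewrite lecR.
Qed.

End exchange.

(** * A test function that reproduces the value at 0 of polynomials *)

(** Take E of maximal rank among the matrices with rows in S: adding another element of
    S to its row space cannot increase the rank. *)
Lemma subspace_rowspace (F : fieldType) n (S : set 'rV[F]_n) : S 0 ->
  (forall a u v, S u -> S v -> S (a *: u + v)) ->
  exists E : 'M[F]_n, forall v, S v <-> (v <= E)%MS.
Proof.
move=> S0 Slin.
have Ssub (E : 'M[F]_n) v : (forall i, S (row i E)) -> (v <= E)%MS -> S v.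
  move=> SE /submxP[w ->]; rewrite mulmx_sum_row.
  by elim/big_rec : _ => // i u _; exact: Slin.
pose good k := `[< exists E : 'M[F]_n, (forall i, S (row i E)) /\ \rank E = k >].
have good0 : exists k, good k.
  exists 0%N; apply/asboolP; exists 0; split; last exact: mxrank0.
  by move=> i; rewrite row0.
have good_le k : good k -> (k <= n)%N by move=> /asboolP[E [_ <-]]; exact: rank_leq_row.
have [r /asboolP[E [SE Er]] rmax] := ex_maxnP good0 good_le.
exists E => v; split; last exact: Ssub.
move=> Sv; pose E' := (E + v)%MS.
have : good (\rank E').
  apply/asboolP; exists E'; split => // i.
  have /sub_addsmxP[[w1 w2] /= ->] := row_sub i E'.
  have -> : w2 *m v = w2 0 0 *: v by rewrite {1}[w2]mx11_scalar mul_scalar_mx.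
  rewrite addrC; apply: Slin => //; apply: (Ssub E) => //; exact: submxMl.
move=> /rmax; rewrite -Er => le.
have sE : (E <= E')%MS by exact: addsmxSl.
have E'E : (E' <= E)%MS by rewrite -(geq_leqif (mxrank_leqif_sup sE)).
exact: submx_trans (addsmxSr E v) E'E.
Qed.

Section moments.
Context {R : realType} {d : nat}.
Notation V := 'cV[R]_d.
Notation D := (test_fun R d).
Notation mR := (measurableTypeR R).
Notation T := (d.-tuple mR).
Notation LT := (caratheodory_type (mu_ext (borel_lebesgue (R:=R) d))).
Notation mu := (lebesgue (R:=R) d).

Lemma continuous_locally_rintegrable (g : V -> R) : continuous g -> locally_rintegrable g.
Proof.
move=> cg K cK.
have mK : measurable (vec @^-1` K : set LT).
  apply: borel_lebesgue_measurable; rewrite -[K]setCK preimage_setC; apply: measurableC.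
  apply: (@measurable_open_preimage R d (~` K)); apply: closed_openC.
  by apply: compact_closed => //; exact: norm_hausdorff.
have [L KL] := compact_sub_sup_box cK.
have muK : (mu (vec @^-1` K) < +oo)%E.
  apply: le_lt_trans (lebesgue_closed_cube_lty (L%:R : R)).
  apply: le_measure; rewrite ?inE//.
    by apply: borel_lebesgue_measurable; exact: measurable_closed_cube.
  by move=> t /KL; exact: (closed_cubeP _ _).2.
have mg : measurable_fun (vec @^-1` K : set LT) (fun t : LT => g (vec t)).
  apply: (measurable_funS measurableT (@subsetT _ _)).
  exact: (completed_measurable_fun (measurable_continuous_vec cg)).
have : compact (g @` K) by apply: continuous_compact => //; exact: continuous_subspaceT.
move=> /compact_bounded[M [Mr MP]].
apply: (measurable_bounded_integrable mK muK mg).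
exists M; split => // x Mx t /= Kt.
by apply: MP => //; exists (vec t).
Qed.

Definition compact_smooth (g : V -> R) :=
  smooth g /\ exists2 K : set V, compact K & forall x, g x != 0 -> K x.

Lemma compact_smooth_bump k a b : 0 < k -> compact_smooth (box_bump k a b).
Proof.
move=> k0; split; first exact: smooth_bump.
exists [set x | forall i, a i <= x i 0 <= b i]; first exact: compact_box.
by move=> x /(bump_out k0) h i; have /andP[/ltW-> /ltW->] := h i.
Qed.

Lemma compact_smooth_integrable g h : compact_smooth g -> continuous h ->
  mu.-integrable setT (fun t => (g (vec t) * h (vec t))%:E).
Proof.
move=> [sg [K /compact_sub_sup_box[L KL] gK]] ch.
apply: (@integrable_compact_support _ _ L (fun x => g x * h x)).
  have cg : continuous g by move=> x; exact/differentiable_continuous/(sg [::]).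
  by move=> x; apply: continuousM; [exact: cg|exact: ch].
by move=> x; rewrite mulf_eq0 negb_or => /andP[/gK/KL].
Qed.

Lemma compact_smooth_test g : compact_smooth g ->
  exists u : D, forall x, u x = (g x)%:C.
Proof.
move=> [sg [K cK gK]].
have tg : ((fun x => (g x)%:C : R[i]^o) : V -> R[i]^o) \in test_pred.
  rewrite inE; split.
    by split; [exact: sg|exact: (@smooth_cst R d 0)].
  apply: (compact_tsupp cK) => x nz; apply: gK; apply: contra_neq nz => /= ->.
  by [].
by exists (TestFun tg).
Qed.

Lemma compact_smooth_lin a g h : compact_smooth g -> compact_smooth h ->
  compact_smooth (fun x => a * g x + h x).
Proof.
move=> [sg [K cK gK]] [sh [K' cK' hK]]; split.
  rewrite (_ : (fun x => _) = (fun x => a * g x + 1 * h x)).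
    exact: smooth_lin.
  by apply/funext => x; rewrite mul1r.
exists (K `|` K'); first exact: compactU.
move=> x nz; have [g0|/gK] := eqVneq (g x) 0; last by left.
by right; apply: hK; move: nz; rewrite g0 mulr0 add0r.
Qed.

Lemma compact_smooth_integral_lin a g h q : compact_smooth g -> compact_smooth h ->
  continuous q ->
  \int[mu]_t ((a * g (vec t) + h (vec t)) * q (vec t)) =
  a * \int[mu]_t (g (vec t) * q (vec t)) + \int[mu]_t (h (vec t) * q (vec t)).
Proof.
move=> cg ch cq; have ig := compact_smooth_integrable cg cq.
have ih := compact_smooth_integrable ch cq.
rewrite -RintegralZl// -RintegralD//; last exact: (integrableZl measurableT a ig).
by apply: eq_Rintegral => t _; rewrite mulrDl mulrA.
Qed.

Lemma integral_rpoly m g (c : {ffun 'I_d -> 'I_m.+1} -> R) : compact_smooth g ->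
  \int[mu]_t (g (vec t) * \sum_al c al * rmonom (fun i => al i) (vec t)) =
  \sum_al c al * \int[mu]_t (g (vec t) * rmonom (fun i => al i) (vec t)).
Proof.
move=> cg; have imono al := compact_smooth_integrable cg (@rmonom_continuous R d (fun i => (al : {ffun 'I_d -> 'I_m.+1}) i)).
under eq_Rintegral do rewrite mulr_sumr.
rewrite /Rintegral.
under eq_integral do rewrite -sumEFin.
rewrite integral_sum//; last first.
  move=> al; have := integrableZl measurableT (c al) (imono al).
  by apply: eq_integrable => // t _; rewrite -EFinM mulrCA.
rewrite -sum_fine => [|al _]; last first.
  apply: integrable_fin_num => //; have := integrableZl measurableT (c al) (imono al).
  by apply: eq_integrable => // t _; rewrite -EFinM mulrCA.
apply: eq_bigr => al _; rewrite -[RHS]RintegralZl//; last exact: imono.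
by rewrite /Rintegral; congr fine; apply: eq_integral => t _; rewrite mulrCA.
Qed.

(** The vectors of moments of compactly supported smooth functions form a subspace of
    a finite dimensional space. If the vector of the values at 0 of the monomials were
    outside of it, a linear form would vanish on all moments but not on this vector. Its
    coefficients define a polynomial q that is orthogonal to all bumps, hence zero, yet
    does not vanish at 0. *)
Lemma reproducing_kernel m : exists2 g, compact_smooth g &
  forall q, rpoly m q -> \int[mu]_t (g (vec t) * q (vec t)) = q 0.
Proof.
pose I := {ffun 'I_d -> 'I_m.+1}.
pose mono (k : 'I_#|{: I}|) : V -> R := rmonom (fun i => (enum_val k : I) i).
pose S : set 'rV[R]_#|{: I}| := [set v | exists2 g, compact_smooth g &
  forall k, v 0 k = \int[mu]_t (g (vec t) * mono k (vec t))].
have cmono k : continuous (mono k) by exact: rmonom_continuous.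
have bump0 : compact_smooth (cst (0 : R) : V -> R).
  split; first exact: smooth_cst.
  by exists set0; [exact: compact0|move=> x; rewrite eqxx].
have [||E SE] := @subspace_rowspace R _ S.
- exists (cst 0) => // k; rewrite mxE.
  under eq_Rintegral do rewrite mul0r.
  by rewrite Rintegral_cst// mul0r.
- move=> a u v [g cg gu] [h ch hv]; exists (fun x => a * g x + h x).
    exact: compact_smooth_lin.
  by move=> k; rewrite !mxE gu hv compact_smooth_integral_lin.
have sumE (F : I -> R) : \sum_al F al = \sum_(k < #|{: I}|) F (enum_val k).
  rewrite [RHS](reindex (@enum_rank I)); last by apply: onW_bij; exact: enum_rank_bij.
  by apply: eq_bigr => al _; rewrite enum_rankK.
pose target : 'rV[R]_#|{: I}| := \row_k mono k 0.
have /SE[g cg gE] : (target <= E)%MS.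
  rewrite submxE; apply: contraT => /rV0Pn[k /negP]; case.
  (* a column of the cokernel is a linear form that vanishes on the row space of E *)
  pose c al := cokermx E (enum_rank al) k.
  pose q x := \sum_(al : I) c al * rmonom (fun i => al i) x.
  have coord (w : 'rV[R]_#|{: I}|) : (w *m cokermx E) 0 k = \sum_(al : I) c al * w 0 (enum_rank al).
    by rewrite mxE sumE; apply: eq_bigr => l _; rewrite /c enum_valK mulrC.
  have cq : continuous q.
    apply: (@rpoly_continuous R d (d * m)).
    apply: rpoly_sum => al _; apply: rpoly_monom.
    apply: (@leq_trans (\sum_(i < d) m)); last by rewrite sum_nat_const card_ord.
    by apply: leq_sum => i _; rewrite -ltnS.
  have q0 g : compact_smooth g -> \int[mu]_t (g (vec t) * q (vec t)) = 0.
    move=> cg; rewrite /q integral_rpoly//.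
    pose w : 'rV[R]_#|{: I}| := \row_l \int[mu]_t (g (vec t) * mono l (vec t)).
    have Sw : S w by exists g => // l; rewrite mxE.
    transitivity ((w *m cokermx E) 0 k).
      by rewrite coord; apply: eq_bigr => al _; rewrite mxE /mono enum_rankK.
    by have /SE := Sw; rewrite submxE => /eqP ->; rewrite mxE.
  have -> : (target *m cokermx E) 0 k = q 0.
    by rewrite coord; apply: eq_bigr => al _; rewrite mxE /mono enum_rankK.
  suff -> : q = cst 0 by [].
  apply: continuous_ae_eq => //; first by move=> x; exact: cst_continuous.
  apply: du_bois_reymond.
  - exact: continuous_locally_rintegrable.
  - by apply: continuous_locally_rintegrable => x; exact: cst_continuous.
  - move=> l a b l0; under eq_Rintegral do rewrite mulrC.
    rewrite q0; last exact: compact_smooth_bump.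
    under eq_Rintegral do rewrite mul0r.
    by rewrite Rintegral_cst// mul0r.
exists g => // q [c ->].
pose c' (al : I) := if (\sum_i al i <= m)%N then c al else 0.
have qE x : \sum_(al : I | (\sum_i al i <= m)%N) c al * rmonom (fun i => al i) x =
    \sum_al c' al * rmonom (fun i => al i) x.
  rewrite big_mkcond; apply: eq_bigr => al _; rewrite /c'.
  by case: ifP => // _; rewrite mul0r.
under eq_Rintegral do rewrite qE.
rewrite qE integral_rpoly// !sumE; apply: eq_bigr => k _.
by have := gE k; rewrite mxE => <-.
Qed.
End moments.

(** * Distributions in a finite dimensional invariant space *)

Section distributions.
Context {R : realType} {d : nat}.
Notation V := 'cV[R]_d.
Notation D := (test_fun R d).
Notation mu := (lebesgue (R:=R) d).
Implicit Types f g : D -> R[i]^o.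

Lemma eq_test (u v : D) : (forall x, u x = v x) -> u = v.
Proof. by move=> uv; apply: val_inj; apply/funext. Qed.

(** Differences of h |-> f (test_shift (- h) u) are differences of f applied to
    translates of u, so those of high order vanish when f generates a finite dimensional
    space. *)
Lemma fdiff_pairing f (u : D) (k : V) n :
  iter n (fdiff k) (fun h => f (test_shift (- h) u) : R[i]^o) =
  (fun h => (iter n (fun g => distr_shift k g - g) f) (test_shift (- h) u)).
Proof.
elim: n => //= n ->; apply/funext => h; rewrite /fdiff.
set g := iter n _ f.
rewrite -[RHS]/(g (test_shift (- k) (test_shift (- h) u)) - g (test_shift (- h) u)).
congr (g _ - _); apply: eq_test => x.
by rewrite /= /shift_fun opprD addrA addrAC.
Qed.

Lemma distribution_unipotent (W : set (D -> R[i]^o)) : (2 <= d)%N ->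
  (forall g, W g -> is_distribution g) -> finite_dim_subspace W ->
  (forall (h : V) g, W g -> W (distr_shift h g)) ->
  (forall (P : 'M[R]_d) (uP : P \in unitmx), P^T = invmx P ->
     forall g, W g -> W (distr_comp uP g)) ->
  exists n, forall g i t, W g ->
    iter n (fun g => distr_shift (t *: delta_mx i 0) g - g) g = 0.
Proof.
move=> d2 Wd fW Wshift Worth.
apply: (@unipotent_translations R d _ W distr_shift d2 fW) => //.
- move=> h k g; apply/funext => u; congr (g _); apply: eq_test => x.
  by rewrite /= /shift_fun opprD addrA addrAC.
- move=> g; apply/funext => u; congr (g _); apply: eq_test => x.
  by rewrite /= /shift_fun oppr0 addr0.
move=> P uP oP; exists (distr_comp uP); split.
- move=> a g h; apply/funext => u; rewrite /distr_comp !fctE.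
  by rewrite mulrDr; congr (_ + _); rewrite /GRing.scale/= mulrCA.
- move=> g h gh; apply/funext => u.
  have := congr1 (fun k => k (test_comp uP u)) gh; rewrite /distr_comp.
  have c0 : (`|\det P|^-1)%:C != 0 :> R[i].
    apply/eqP => -[] /eqP; rewrite invr_eq0 normr_eq0 => /eqP det0.
    by have := uP; rewrite unitmxE det0 unitr0.
  have -> : test_comp (invmx_unitmx uP) (test_comp uP u) = u.
    by apply: eq_test => x; rewrite /= /comp_mx mulmxA mulmxV// mul1mx.
  by move/(mulfI c0).
- by move=> g; exact: Worth.
- move=> h g; apply/funext => u; rewrite /distr_comp /distr_shift; congr (_ * g _).
  apply: eq_test => x; rewrite /= /shift_fun /comp_mx mulmxDr mulmxN mulmxA.
  by rewrite mulVmx// mul1mx.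
Qed.

Lemma cintegral_real_mul (g : V -> R) (p : V -> R[i]^o) :
  cintegral (fun x => (g x)%:C * p x) =
  (\int[mu]_t (g (vec t) * complex.Re (p (vec t)))) +i*
  (\int[mu]_t (g (vec t) * complex.Im (p (vec t)))).
Proof.
rewrite /cintegral; congr (_ +i* _); apply: eq_Rintegral => t _.
  by case: (p _) => a b /=; rewrite mul0r subr0.
by case: (p _) => a b /=; rewrite mul0r addr0.
Qed.

(** With psi reproducing the value at 0 of polynomials of degree at most d n, the
    value f u = F u 0 is the integral of psi F u, which by [convolution_exchange] is
    the integral of u F psi. *)
Lemma distribution_polynomial (W : set (D -> R[i]^o)) f : (2 <= d)%N ->
  (forall g, W g -> is_distribution g) -> finite_dim_subspace W -> W f ->
  (forall (h : V) g, W g -> W (distr_shift h g)) ->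
  (forall (P : 'M[R]_d) (uP : P \in unitmx), P^T = invmx P ->
     forall g, W g -> W (distr_comp uP g)) ->
  exists2 p : V -> R[i]^o, (exists m, cpoly m p) & f = distr_of p.
Proof.
move=> d2 Wd fW Wf Wshift Worth.
have df := Wd f Wf.
have [n Wn] := distribution_unipotent d2 Wd fW Wshift Worth.
pose F (u : D) (h : V) : R[i]^o := f (test_shift (- h) u).
have pF u : cpoly (d * n) (F u).
  apply: cfrechet; first exact: translate_continuous.
  by move=> i t; rewrite fdiff_pairing Wn.
have [k ck kP] := @reproducing_kernel R d (d * n).
have [psi psiE] := compact_smooth_test ck.
exists (F psi); first by exists (d * n)%N.
apply/funext => u; rewrite /distr_of.
have -> : (fun x => F psi x * u x) = (fun x => u x * F psi x).
  by apply/funext => x; rewrite mulrC.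
rewrite -(convolution_exchange u psi df).
have -> : (fun x => psi x * f (test_shift (- x) u)) = (fun x => (k x)%:C * F u x).
  by apply/funext => x; rewrite psiE.
have [pr pi] := pF u.
rewrite cintegral_real_mul (kP _ pr) (kP _ pi).
have F0 : F u 0 = f u.
  by congr (f _); apply: eq_test => x; rewrite /= /shift_fun oppr0 addr0.
by rewrite /= F0; case: (f u).
Qed.

(** Bumps are real test functions, so the real and imaginary parts can be compared
    separately. *)
Lemma distr_of_inj_ae (g p : V -> R[i]^o) : locally_cintegrable g ->
  locally_cintegrable p -> distr_of g = distr_of p -> eq_ae g p.
Proof.
move=> lg lp gp.
have bumps k a b : 0 < k ->
    cintegral (fun x => (box_bump k a b x)%:C * g x) =
    cintegral (fun x => (box_bump k a b x)%:C * p x).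
  move=> k0; have [u uE] := compact_smooth_test (@compact_smooth_bump R d k a b k0).
  have := congr1 (fun h => h u) gp; rewrite /distr_of.
  have E (q : V -> R[i]^o) : (fun x => q x * u x) = (fun x => (box_bump k a b x)%:C * q x).
    by apply/funext => x; rewrite uE mulrC.
  by rewrite !E.
have [aer aei] : {ae mu, forall t, complex.Re (g (vec t)) = complex.Re (p (vec t))} /\
    {ae mu, forall t, complex.Im (g (vec t)) = complex.Im (p (vec t))}.
  split.
  - apply: (@du_bois_reymond R d (@complex.Re R \o g) (@complex.Re R \o p)).
    + by move=> K /lg[].
    + by move=> K /lp[].
    + move=> k a b /(bumps _ a b); rewrite !cintegral_real_mul => -[h _].
      under eq_Rintegral do rewrite mulrC.
      by under [RHS]eq_Rintegral do rewrite mulrC.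
  - apply: (@du_bois_reymond R d (@complex.Im R \o g) (@complex.Im R \o p)).
    + by move=> K /lg[].
    + by move=> K /lp[].
    + move=> k a b /(bumps _ a b); rewrite !cintegral_real_mul => -[_ h].
      under eq_Rintegral do rewrite mulrC.
      by under [RHS]eq_Rintegral do rewrite mulrC.
apply: negligibleS (negligibleU aer aei) => t /= ne.
apply: contrapT => /not_orP[/contrapT hr /contrapT hi]; apply: ne.
by apply/eqP; rewrite eq_complex hr hi !eqxx.
Qed.

Lemma continuous_locally_cintegrable (g : V -> R[i]^o) : continuous g -> locally_cintegrable g.
Proof.
move=> /continuous_parts[cr ci] K cK; split.
  exact: (continuous_locally_rintegrable cr).
exact: (continuous_locally_rintegrable ci).
Qed.

Lemma continuous_eq_ae (g p : V -> R[i]^o) : continuous g -> continuous p ->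
  eq_ae g p -> g = p.
Proof.
move=> /continuous_parts[gr gi] /continuous_parts[pr pi] gp.
have er : @complex.Re R \o g = @complex.Re R \o p.
  by apply: continuous_ae_eq => //; apply: negligibleS gp => t /= ne gpt; apply: ne; rewrite gpt.
have ei : @complex.Im R \o g = @complex.Im R \o p.
  by apply: continuous_ae_eq => //; apply: negligibleS gp => t /= ne gpt; apply: ne; rewrite gpt.
apply/funext => x; apply/eqP; rewrite eq_complex.
by rewrite (congr1 (fun h => h x) er : complex.Re (g x) = _)
  (congr1 (fun h => h x) ei : complex.Im (g x) = _) !eqxx.
Qed.

Lemma cpoly_continuous m (p : V -> R[i]^o) : cpoly m p -> continuous p.
Proof.
by move=> [pr pi]; apply/continuous_parts; split; apply: rpoly_continuous; [exact: pr|exact: pi].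
Qed.

End distributions.

Theorem theorem2p1 (R : realType) (d : nat) (hd : (2 <= d)%N) :
  (forall (V : set (test_fun R d -> R[i]^o)) (f : test_fun R d -> R[i]^o),
     (forall g, V g -> is_distribution g) ->
     finite_dim_subspace V ->
     V f ->
     (forall (h : 'cV[R]_d) g, V g -> V (distr_shift h g)) ->
     (forall (P : 'M[R]_d) (uP : P \in unitmx), P^T = invmx P ->
        forall g, V g -> V (distr_comp uP g)) ->
     exists p : 'cV[R]_d -> R[i]^o,
       [/\ is_polynomial p,
           f = distr_of p,
           forall g, locally_cintegrable g -> f = distr_of g -> eq_ae g p
         & forall g, continuous g -> f = distr_of g -> g = p]) /\
  (forall (V : set ('cV[R]_d -> R[i]^o)) (f : 'cV[R]_d -> R[i]^o),
     (forall g, V g -> continuous g) ->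
     finite_dim_subspace V ->
     V f ->
     (forall (h : 'cV[R]_d) g, V g -> V (shift_fun h g)) ->
     (forall P : 'M[R]_d, P \in unitmx -> P^T = invmx P ->
        forall g, V g -> V (comp_mx P g)) ->
     exists p : 'cV[R]_d -> R[i]^o,
       [/\ is_polynomial p,
           distr_of f = distr_of p,
           eq_ae f p
         & f = p]).
Proof.
split=> [V f Vd fV Vf Vshift Vorth|V f Vc fV Vf Vshift Vorth].
  have [p [m pm] fp] := distribution_polynomial hd Vd fV Vf Vshift Vorth.
  have cp := cpoly_continuous pm.
  have ae g : locally_cintegrable g -> f = distr_of g -> eq_ae g p.
    move=> lg fg; apply: distr_of_inj_ae => //.
      exact: continuous_locally_cintegrable.
    by rewrite -fg.
  exists p; split => //; first exact: cpoly_is_polynomial pm.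
  move=> g cg fg; apply: continuous_eq_ae => //; apply: ae => //.
  exact: continuous_locally_cintegrable.
exists f; split => //; first exact: continuous_invariant_polynomial hd Vc fV Vf Vshift Vorth.
by apply: aeW.
Qed.
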